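(* $\mathsf{RCA}_0$ proves: every matroid $(M,D)$ has a basis.
   Context: Work in second-order arithmetic. A matroid is a pair $(M,D)$ with $M\subseteq\mathbb{N}$ and $D$ a set of (codes of) finite subsets of $M$ (the finite dependent sets) such that: (i) $\emptyset\notin D$; (ii) if $X\in D$ and $X\subseteq Y$ with $Y$ a finite subset of $M$, then $Y\in D$; (iii) for all finite $X,Y\subseteq M$ with $|X|<|Y|$ and $X,Y\notin D$, there is $y\in Y$ with $X\cup\{y\}\notin D$. A set $B\subseteq M$ is independent if no finite subset of $B$ is in $D$; $B$ spans $M$ if for each $x\in M\setminus B$, $B\cup\{x\}$ has a finite subset in $D$; $B$ is a basis if it is independent and spans $M$. *)

(* Defs.v *)
From Stdlib Require Import List.

(** * The language of second-order arithmetic *)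

(* Number variables and set variables are separate families of de Bruijn
   indices: [fAllN] binds number index 0, [fAllS] binds set index 0. *)

Inductive tm : Type :=
| var (x : nat)
| tzero
| tone
| tadd (s t : tm)
| tmul (s t : tm).

Inductive fm : Type :=
| fEq (s t : tm)
| fLt (s t : tm)
| fIn (t : tm) (X : nat)
| fBot
| fImp (A B : fm)
| fAllN (A : fm)
| fAllS (A : fm).

Declare Scope tm_scope.
Delimit Scope tm_scope with tm.
Bind Scope tm_scope with tm.
Declare Scope fm_scope.
Delimit Scope fm_scope with fm.
Bind Scope fm_scope with fm.

Notation "0" := tzero : tm_scope.
Notation "1" := tone : tm_scope.
Notation "s + t" := (tadd s t) : tm_scope.
Notation "s * t" := (tmul s t) : tm_scope.

(* The logic is classical, so the other connectives are abbreviations. *)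
Definition fNeg (A : fm) : fm := fImp A fBot.
Definition fAnd (A B : fm) : fm := fNeg (fImp A (fNeg B)).
Definition fOr (A B : fm) : fm := fImp (fNeg A) B.
Definition fIff (A B : fm) : fm := fAnd (fImp A B) (fImp B A).
Definition fExN (A : fm) : fm := fNeg (fAllN (fNeg A)).
Definition fExS (A : fm) : fm := fNeg (fAllS (fNeg A)).

Notation "s = t" := (fEq s%tm t%tm) : fm_scope.
Notation "s < t" := (fLt s%tm t%tm) : fm_scope.
Notation "~ A" := (fNeg A) : fm_scope.
Notation "A /\ B" := (fAnd A B) : fm_scope.
Notation "A \/ B" := (fOr A B) : fm_scope.
Notation "A <-> B" := (fIff A B) : fm_scope.
Notation "A ⟶ B" := (fImp A B)
  (at level 99, right associativity, B at level 200) : fm_scope.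

(** * Substitution *)

Fixpoint subst_tm (f : nat -> tm) (t : tm) : tm :=
  match t with
  | var x => f x
  | tzero => tzero
  | tone => tone
  | tadd s t => tadd (subst_tm f s) (subst_tm f t)
  | tmul s t => tmul (subst_tm f s) (subst_tm f t)
  end.

Definition lift (k : nat) (t : tm) : tm := subst_tm (fun x => var (k + x)) t.

Definition scons {T : Type} (a : T) (f : nat -> T) (n : nat) : T :=
  match n with O => a | S m => f m end.

(* [f] acts on number variables; [r] renames set variables, which are the only
   set terms of the language. *)
Fixpoint subst (f : nat -> tm) (r : nat -> nat) (A : fm) : fm :=
  match A with
  | fEq s t => fEq (subst_tm f s) (subst_tm f t)
  | fLt s t => fLt (subst_tm f s) (subst_tm f t)
  | fIn t X => fIn (subst_tm f t) (r X)
  | fBot => fBot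
  | fImp A B => fImp (subst f r A) (subst f r B)
  | fAllN A => fAllN (subst (scons (var 0) (fun x => lift 1 (f x))) r A)
  | fAllS A => fAllS (subst f (scons 0 (fun X => S (r X))) A)
  end.

Definition idr (X : nat) : nat := X.

Definition shiftN (A : fm) : fm := subst (fun x => var (S x)) idr A.
Definition shiftS (A : fm) : fm := subst var S A.
Definition instN (A : fm) (t : tm) : fm := subst (scons t var) idr A.
Definition instS (A : fm) (X : nat) : fm := subst var (scons X idr) A.

(** * Classical two-sorted natural deduction *)

(* By [prv_ax] an axiom of [T] is available in every context, and contexts, but
   not [T], are shifted by the introduction rules for the quantifiers.  Hence
   the free variables of the axioms in [T] are read as universally quantified:
   [T] is equivalent to the set of universal closures of its members. *)
Inductive prv (T : fm -> Prop) : list fm -> fm -> Prop :=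
| prv_ax G A : T A -> prv T G A
| prv_hyp G A : List.In A G -> prv T G A
| prv_impI G A B : prv T (A :: G) B -> prv T G (fImp A B)
| prv_impE G A B : prv T G (fImp A B) -> prv T G A -> prv T G B
| prv_dne G A : prv T G (fNeg (fNeg A)) -> prv T G A
| prv_allNI G A : prv T (map shiftN G) A -> prv T G (fAllN A)
| prv_allNE G A t : prv T G (fAllN A) -> prv T G (instN A t)
| prv_allSI G A : prv T (map shiftS G) A -> prv T G (fAllS A)
| prv_allSE G A X : prv T G (fAllS A) -> prv T G (instS A X)
| prv_refl G t : prv T G (fEq t t)
| prv_leibniz G A s t :
    prv T G (fEq s t) -> prv T G (instN A s) -> prv T G (instN A t).

Definition proves (T : fm -> Prop) (A : fm) : Prop := prv T nil A.

(** * The axioms of RCA_0 *)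

(* A bounded existential quantifier is written
   [~ fAllN (var 0 < lift 1 t ⟶ ~ A)], so it needs no clause of its own. *)
Inductive bounded : fm -> Prop :=
| bounded_eq s t : bounded (fEq s t)
| bounded_lt s t : bounded (fLt s t)
| bounded_in t X : bounded (fIn t X)
| bounded_bot : bounded fBot
| bounded_imp A B : bounded A -> bounded B -> bounded (fImp A B)
| bounded_all t A : bounded A -> bounded (fAllN (var 0 < lift 1 t ⟶ A)).

Inductive Sigma01 : fm -> Prop :=
| Sigma01_intro A : bounded A -> Sigma01 (fExN A).

Inductive Pi01 : fm -> Prop :=
| Pi01_intro A : bounded A -> Pi01 (fAllN A).

Inductive basic : fm -> Prop :=
| basic_succ_neq0 :
    basic (fAllN (~ (var 0 + 1 = 0)))
| basic_succ_inj :
    basic (fAllN (fAllN (var 1 + 1 = var 0 + 1 ⟶ var 1 = var 0)))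
| basic_add0 :
    basic (fAllN (var 0 + 0 = var 0))
| basic_addS :
    basic (fAllN (fAllN (var 1 + (var 0 + 1) = (var 1 + var 0) + 1)))
| basic_mul0 :
    basic (fAllN (var 0 * 0 = 0))
| basic_mulS :
    basic (fAllN (fAllN (var 1 * (var 0 + 1) = var 1 * var 0 + var 1)))
| basic_lt0 :
    basic (fAllN (~ (var 0 < 0)))
| basic_ltS :
    basic (fAllN (fAllN
      (var 1 < var 0 + 1 <-> (var 1 < var 0 \/ var 1 = var 0)))).

(* For a formula [A] in the number variable 0: [A] with 0 replaced by 0 + 1. *)
Definition succ_inst (A : fm) : fm :=
  subst (scons (var 0 + 1)%tm (fun x => var (S x))) idr A.

Definition induction (A : fm) : fm :=
  (instN A 0 /\ fAllN (A ⟶ succ_inst A)) ⟶ fAllN A.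

(* The shift makes the comprehended set not occur in [A]. *)
Definition delta_comprehension (A B : fm) : fm :=
  fAllN (A <-> B) ⟶ fExS (fAllN (fIn (var 0) 0 <-> shiftS A)).

Inductive RCA0 : fm -> Prop :=
| RCA0_basic A : basic A -> RCA0 A
| RCA0_induction A : Sigma01 A -> RCA0 (induction A)
| RCA0_comprehension A B :
    Sigma01 A -> Pi01 B -> RCA0 (delta_comprehension A B).

(** * Codes of finite sets *)

Definition fle (s t : tm) : fm := s < t \/ s = t.

Definition divides (s t : tm) : fm := fExN (lift 1 t = lift 1 s * var 0).

(* The pairing function (i, j) |-> (i + j)^2 + i. *)
Definition tpair (i j : tm) : tm := (i + j) * (i + j) + i.

(* The triple (k, (m, n)) represents the finite set
   {i < k : m (i + 1) + 1 divides n}. *)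
Definition ttriple (k m n : tm) : tm := tpair k (tpair m n).

Definition beta_mem (i k m n : tm) : fm :=
  i < k /\ divides (m * (i + 1) + 1) n.

(* The code of a finite set is the least triple representing it. *)
Definition is_code (c : tm) : fm :=
  fExN (fExN (fExN (
    lift 3 c = ttriple (var 2) (var 1) (var 0) /\
    fAllN (fAllN (fAllN (
      fAllN (beta_mem (var 0) (var 6) (var 5) (var 4) <->
            beta_mem (var 0) (var 3) (var 2) (var 1)) ⟶
      fle (lift 6 c) (ttriple (var 2) (var 1) (var 0)))))))).

Definition fmem (i c : tm) : fm :=
  fExN (fExN (fExN (
    lift 3 c = ttriple (var 2) (var 1) (var 0) /\
    beta_mem (lift 3 i) (var 2) (var 1) (var 0)))).

Definition fempty (c : tm) : fm := fAllN (~ fmem (var 0) (lift 1 c)).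

Definition fsubset (c d : tm) : fm :=
  fAllN (fmem (var 0) (lift 1 c) ⟶ fmem (var 0) (lift 1 d)).

(* d = c ∪ {y} *)
Definition is_add (d c y : tm) : fm :=
  fAllN (fmem (var 0) (lift 1 d) <->
         (fmem (var 0) (lift 1 c) \/ var 0 = lift 1 y)).

(* c is the code of a finite subset of the set X *)
Definition fin_subset (c : tm) (X : nat) : fm :=
  is_code c /\ fAllN (fmem (var 0) (lift 1 c) ⟶ fIn (var 0) X).

(* f is the code of (the graph of) a bijection from {0, ..., n - 1} onto the
   set coded by c. *)
Definition bijection (f n c : tm) : fm :=
  is_code f /\
  fAllN (fmem (var 0) (lift 1 f) ⟶
    fExN (fExN (var 2 = tpair (var 1) (var 0) /\
              var 1 < lift 3 n /\ fmem (var 0) (lift 3 c)))) /\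
  fAllN (var 0 < lift 1 n ⟶ fExN (fmem (tpair (var 1) (var 0)) (lift 2 f))) /\
  fAllN (fmem (var 0) (lift 1 c) ⟶
    fExN (fmem (tpair (var 0) (var 1)) (lift 2 f))) /\
  fAllN (fAllN (fAllN (
    fmem (tpair (var 2) (var 1)) (lift 3 f) /\
    fmem (tpair (var 2) (var 0)) (lift 3 f) ⟶ var 1 = var 0))) /\
  fAllN (fAllN (fAllN (
    fmem (tpair (var 2) (var 0)) (lift 3 f) /\
    fmem (tpair (var 1) (var 0)) (lift 3 f) ⟶ var 2 = var 1))).

Definition card (c n : tm) : fm :=
  fExN (bijection (var 0) (lift 1 n) (lift 1 c)).

Definition card_lt (c d : tm) : fm :=
  fExN (fExN (
    card (lift 2 c) (var 1) /\ card (lift 2 d) (var 0) /\ var 1 < var 0)).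

(** * Matroids and bases *)

(* In the exchange clause the witness y ranges over Y, not only over Y \ X. *)
Definition matroid (M D : nat) : fm :=
  fAllN (fIn (var 0) D ⟶ fin_subset (var 0) M) /\
  fAllN (is_code (var 0) /\ fempty (var 0) ⟶ ~ fIn (var 0) D) /\
  fAllN (fAllN (
    fIn (var 1) D /\ fin_subset (var 0) M /\ fsubset (var 1) (var 0) ⟶
    fIn (var 0) D)) /\
  fAllN (fAllN (
    fin_subset (var 1) M /\ fin_subset (var 0) M /\
    card_lt (var 1) (var 0) /\ ~ fIn (var 1) D /\ ~ fIn (var 0) D ⟶
    fExN (fmem (var 0) (var 1) /\
         fExN (is_code (var 0) /\ is_add (var 0) (var 3) (var 1) /\
              ~ fIn (var 0) D)))).

Definition independent (B D : nat) : fm :=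
  fAllN (fin_subset (var 0) B ⟶ ~ fIn (var 0) D).

Definition spans (B M D : nat) : fm :=
  fAllN (fIn (var 0) M /\ ~ fIn (var 0) B ⟶
    fExN (is_code (var 0) /\
         fAllN (fmem (var 0) (var 1) ⟶ (fIn (var 0) B \/ var 0 = var 2)) /\
         fIn (var 0) D)).

Definition basis (B M D : nat) : fm :=
  fAllN (fIn (var 0) B ⟶ fIn (var 0) M) /\ independent B D /\ spans B M D.

Definition every_matroid_has_a_basis : fm :=
  fAllS (fAllS (matroid 1 0 ⟶ fExS (basis 0 2 1))).

(* Main.v *)
(* By the completeness theorem it suffices to argue in an arbitrary, possibly
   nonstandard, model of RCA_0.  There every element x of M is kept in the basis
   B exactly when the finite set of earlier kept elements together with x is not
   in D.  The set of elements kept below x has a code by Sigma^0_1 induction on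
   x, and it is unique, so B is Delta^0_1.  Every finite subset of B is contained
   in one of these independent finite sets, and a rejected x forms a dependent
   set with the elements kept before it. *)

From Stdlib Require Import List Arith Lia Cantor.
From Stdlib Require Import Classical ClassicalEpsilon FunctionalExtensionality.
From Stdlib Require Import PropExtensionality ProofIrrelevance.
Require Import Defs.
Import ListNotations.

(** The obstacle is that deciding whether x is kept means testing the code of a finite set for
    membership in D, and no term of the language is available to bound that code in x. The record of
    the decisions therefore comes with a number [w] above every code involved. That a record exists
    is then one unbounded existential quantifier before a bounded formula, the form that the
    induction and comprehension schemes accept. As D is a set of numbers, the code tested must
    depend on the finite set alone; minimality of codes provides this. The language has only sum and
    product, so finite sets rest on Gödel's beta function, and even its base modulus is obtained by
    Sigma^0_1 induction. To keep formulas out of the combinatorial argument, definability is a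
    property of Rocq predicates on environments that is closed under the bounded operations, and a
    tactic discharges it. *)

(** * Substitution calculus *)

Definition up (f : nat -> tm) : nat -> tm := scons (var 0) (fun x => lift 1 (f x)).

Lemma subst_tm_comp g f t :
  subst_tm g (subst_tm f t) = subst_tm (fun x => subst_tm g (f x)) t.
Proof. induction t; simpl; congruence. Qed.

Lemma subst_tm_var t : subst_tm var t = t.
Proof. induction t; simpl; congruence. Qed.

Lemma subst_tm_lift1 f t : subst_tm f (lift 1 t) = subst_tm (fun x => f (S x)) t.
Proof. apply subst_tm_comp. Qed.

Lemma up_comp g f :
  (fun x => subst_tm (up g) (up f x)) = up (fun x => subst_tm g (f x)).
Proof.
  extensionality x. destruct x as [|x]; [reflexivity|].
  simpl. rewrite subst_tm_lift1. unfold lift. rewrite subst_tm_comp. reflexivity.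
Qed.

Lemma up_var : up var = var.
Proof. extensionality x. destruct x; reflexivity. Qed.

Lemma subst_comp g q f r A :
  subst g q (subst f r A) =
  subst (fun x => subst_tm g (f x)) (fun X => q (r X)) A.
Proof.
  revert g q f r; induction A as [s t|s t|t X| |A IHA B IHB|A IH|A IH];
    intros g q f r; simpl; rewrite ?subst_tm_comp, ?IHA, ?IHB; try reflexivity.
  - rewrite IH. f_equal. fold (up f) (up g). rewrite up_comp. reflexivity.
  - rewrite IH. f_equal. f_equal. extensionality X. destruct X; reflexivity.
Qed.

Lemma subst_var A : subst var idr A = A.
Proof.
  induction A as [s t|s t|t X| |A IHA B IHB|A IH|A IH]; simpl;
    rewrite ?subst_tm_var, ?IHA, ?IHB; try reflexivity.
  - fold (up var). rewrite up_var, IH. reflexivity.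
  - replace (scons 0 (fun X => S (idr X))) with idr; [rewrite IH; reflexivity|].
    extensionality X. destruct X; reflexivity.
Qed.

Lemma subst_instN f r A t :
  subst f r (instN A t) = instN (subst (up f) r A) (subst_tm f t).
Proof.
  unfold instN. rewrite !subst_comp. f_equal. extensionality x.
  destruct x as [|x]; simpl; [reflexivity|].
  rewrite subst_tm_lift1. symmetry. apply subst_tm_var.
Qed.

Lemma subst_instS f r A X :
  subst f r (instS A X) = instS (subst f (scons 0 (fun Y => S (r Y))) A) (r X).
Proof.
  unfold instS. rewrite !subst_comp. f_equal; [|extensionality Y; destruct Y; reflexivity].
  extensionality x. symmetry. apply subst_tm_var.
Qed.

Lemma subst_shiftN f r A : subst (up f) r (shiftN A) = shiftN (subst f r A).
Proof. unfold shiftN. rewrite !subst_comp. reflexivity. Qed.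

Lemma subst_shiftS f r A :
  subst f (scons 0 (fun Y => S (r Y))) (shiftS A) = shiftS (subst f r A).
Proof.
  unfold shiftS. rewrite !subst_comp. f_equal.
  extensionality x. symmetry. apply subst_tm_var.
Qed.

Lemma instN_subst_up f r A t :
  instN (subst (up f) r A) t = subst (scons t f) r A.
Proof.
  unfold instN. rewrite subst_comp. f_equal. extensionality x.
  destruct x as [|x]; simpl; [reflexivity|]. rewrite subst_tm_lift1. apply subst_tm_var.
Qed.

Lemma instS_subst_up f r A X :
  instS (subst f (scons 0 (fun Y => S (r Y))) A) X = subst f (scons X r) A.
Proof.
  unfold instS. rewrite subst_comp. f_equal.
  - extensionality x. apply subst_tm_var.
  - extensionality Y. destruct Y; reflexivity.
Qed.

(* An upper bound on the variable indices; not decremented under binders. *)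
Fixpoint bound_tm (t : tm) : nat :=
  match t with
  | var x => S x
  | tzero | tone => 0
  | tadd s t | tmul s t => bound_tm s + bound_tm t
  end.

Fixpoint bound_num (A : fm) : nat :=
  match A with
  | fEq s t | fLt s t => bound_tm s + bound_tm t
  | fIn t _ => bound_tm t
  | fBot => 0
  | fImp A B => bound_num A + bound_num B
  | fAllN A | fAllS A => bound_num A
  end.

Fixpoint bound_set (A : fm) : nat :=
  match A with
  | fIn _ X => S X
  | fEq _ _ | fLt _ _ | fBot => 0
  | fImp A B => bound_set A + bound_set B
  | fAllN A | fAllS A => bound_set A
  end.

Lemma subst_tm_agree f g t :
  (forall x, x < bound_tm t -> f x = g x) -> subst_tm f t = subst_tm g t.
Proof.
  induction t as [x| | |s IHs t IHt|s IHs t IHt]; simpl; intros H; try reflexivity.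
  - apply H; lia.
  - rewrite IHs, IHt; [reflexivity|..]; intros x Hx; apply H; lia.
  - rewrite IHs, IHt; [reflexivity|..]; intros x Hx; apply H; lia.
Qed.

Lemma subst_agree f g r q A :
  (forall x, x < bound_num A -> f x = g x) ->
  (forall X, X < bound_set A -> r X = q X) -> subst f r A = subst g q A.
Proof.
  revert f g r q; induction A as [s t|s t|t X| |A IHA B IHB|A IH|A IH];
    simpl; intros f g r q Hn Hs; try reflexivity.
  - rewrite (subst_tm_agree f g s), (subst_tm_agree f g t); [reflexivity|..];
      intros x Hx; apply Hn; lia.
  - rewrite (subst_tm_agree f g s), (subst_tm_agree f g t); [reflexivity|..];
      intros x Hx; apply Hn; lia.
  - rewrite (subst_tm_agree f g t), Hs; [reflexivity|lia|assumption].
  - rewrite (IHA f g r q), (IHB f g r q); [reflexivity|..]; intros x Hx;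
      (apply Hn || apply Hs); lia.
  - f_equal. apply IH; [|assumption].
    intros [|x] Hx; simpl; [reflexivity|]. rewrite Hn; [reflexivity|lia].
  - f_equal. apply IH; [assumption|].
    intros [|X] HX; simpl; [reflexivity|]. rewrite Hs; [reflexivity|lia].
Qed.

(** * Weakening, substitution and generalization over fresh variables in derivations *)

Lemma prv_weak T G A : prv T G A -> forall G', incl G G' -> prv T G' A.
Proof.
  induction 1 as [| | | | |G A _ IH| |G A _ IH| | |]; intros G' HG.
  - apply prv_ax; assumption.
  - apply prv_hyp; auto.
  - apply prv_impI. apply IHprv. intros C [->|HC]; simpl; auto.
  - eapply prv_impE; auto.
  - apply prv_dne; auto.
  - apply prv_allNI. apply IH. apply incl_map; assumption.
  - apply prv_allNE; auto.
  - apply prv_allSI. apply IH. apply incl_map; assumption.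
  - apply prv_allSE; auto.
  - apply prv_refl.
  - eapply prv_leibniz; auto.
Qed.

Lemma prv_weak_cons T G A B : prv T G A -> prv T (B :: G) A.
Proof. intros H. apply (prv_weak _ _ _ H). intros C HC; right; exact HC. Qed.

Lemma prv_exfalso T G A : prv T G fBot -> prv T G A.
Proof. intros H. apply prv_dne, prv_impI, prv_weak_cons, H. Qed.

Definition subst_closed (T : fm -> Prop) : Prop :=
  forall A f r, T A -> T (subst f r A).

(** Axioms are not shifted with the context, so the axiom case asks that [T] itself be closed under
    substitution. *)
Lemma prv_subst T (HT : subst_closed T) G A :
  prv T G A -> forall f r, prv T (map (subst f r) G) (subst f r A).
Proof.
  induction 1 as [G A HA|G A HA|G A B _ IH|G A B _ IH1 _ IH2|G A _ IH|G A _ IH|G A t _ IH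
    |G A _ IH|G A X _ IH|G t|G A s t _ IH1 _ IH2]; intros f r.
  - apply prv_ax, HT, HA.
  - apply prv_hyp, in_map, HA.
  - apply prv_impI. exact (IH f r).
  - exact (prv_impE _ _ _ _ (IH1 f r) (IH2 f r)).
  - apply prv_dne. exact (IH f r).
  - simpl. apply prv_allNI. fold (up f). specialize (IH (up f) r).
    rewrite map_map in *. erewrite map_ext; [exact IH|].
    intros B. symmetry. apply subst_shiftN.
  - rewrite subst_instN. apply prv_allNE. exact (IH f r).
  - simpl. apply prv_allSI. specialize (IH f (scons 0 (fun Y => S (r Y)))).
    rewrite map_map in *. erewrite map_ext; [exact IH|].
    intros B. symmetry. apply subst_shiftS.
  - rewrite subst_instS. apply prv_allSE. exact (IH f r).
  - apply prv_refl.
  - rewrite subst_instN. apply prv_leibniz with (s := subst_tm f s).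
    + exact (IH1 f r).
    + rewrite <- subst_instN. exact (IH2 f r).
Qed.

Definition fresh_num (y : nat) (A : fm) : Prop := bound_num A <= y.
Definition fresh_set (Y : nat) (A : fm) : Prop := bound_set A <= Y.

(** The renaming that sends [y] to 0 and every other variable one up acts as [shiftN] on formulas
    whose variables lie below [y], and it undoes the instantiation of [A] at [y]. It turns the given
    derivation into a premise of [prv_allNI]. *)
Lemma prv_allNI_fresh T (HT : subst_closed T) G A y :
  Forall (fresh_num y) G -> fresh_num y A ->
  prv T G (instN A (var y)) -> prv T G (fAllN A).
Proof.
  intros HG HA H. apply prv_allNI.
  set (f := fun x => if x =? y then var 0 else var (S x)).
  apply (prv_subst _ HT _ _) with (f := f) (r := idr) in H.
  replace (subst f idr (instN A (var y))) with A in H.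
  - erewrite map_ext_in; [exact H|]. intros B HB. apply subst_agree; [|reflexivity].
    intros x Hx. unfold f. rewrite Forall_forall in HG. specialize (HG B HB).
    unfold fresh_num in HG. destruct (Nat.eqb_spec x y); [lia|reflexivity].
  - unfold instN. rewrite subst_comp. rewrite <- (subst_var A) at 1.
    apply subst_agree; [|reflexivity]. unfold fresh_num in HA.
    intros [|x] Hx; simpl; unfold f.
    + rewrite Nat.eqb_refl; reflexivity.
    + destruct (Nat.eqb_spec x y); [lia|reflexivity].
Qed.

Lemma prv_allSI_fresh T (HT : subst_closed T) G A Y :
  Forall (fresh_set Y) G -> fresh_set Y A ->
  prv T G (instS A Y) -> prv T G (fAllS A).
Proof.
  intros HG HA H. apply prv_allSI.
  set (r := fun X => if X =? Y then 0 else S X).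
  apply (prv_subst _ HT _ _) with (f := var) (r := r) in H.
  replace (subst var r (instS A Y)) with A in H.
  - erewrite map_ext_in; [exact H|]. intros B HB. apply subst_agree; [reflexivity|].
    intros x Hx. unfold r. rewrite Forall_forall in HG. specialize (HG B HB).
    unfold fresh_set in HG. destruct (Nat.eqb_spec x Y); [lia|reflexivity].
  - unfold instS. rewrite subst_comp. rewrite <- (subst_var A) at 1.
    apply subst_agree; [reflexivity|]. unfold fresh_set in HA.
    intros [|x] Hx; simpl; unfold r, idr.
    + rewrite Nat.eqb_refl; reflexivity.
    + destruct (Nat.eqb_spec x Y); [lia|reflexivity].
Qed.

(** * Two-sorted structures and satisfaction *)

Record structure : Type := {
  num : Type;
  sets : Type;
  zero : num;
  one : num;
  add : num -> num -> num;
  mul : num -> num -> num;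
  lt : num -> num -> Prop;
  mem : num -> sets -> Prop }.

Fixpoint eval (M : structure) (e : nat -> num M) (t : tm) : num M :=
  match t with
  | var x => e x
  | tzero => zero M
  | tone => one M
  | tadd s t => add M (eval M e s) (eval M e t)
  | tmul s t => mul M (eval M e s) (eval M e t)
  end.

Fixpoint sat (M : structure) (e : nat -> num M) (q : nat -> sets M) (A : fm) : Prop :=
  match A with
  | fEq s t => eval M e s = eval M e t
  | fLt s t => lt M (eval M e s) (eval M e t)
  | fIn t X => mem M (eval M e t) (q X)
  | fBot => False
  | fImp A B => sat M e q A -> sat M e q B
  | fAllN A => forall a, sat M (scons a e) q A
  | fAllS A => forall X, sat M e (scons X q) A
  end.

Definition models (M : structure) (T : fm -> Prop) : Prop :=
  forall A, T A -> forall e q, sat M e q A.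

(** * Completeness *)

Fixpoint code_tm (t : tm) : nat :=
  match t with
  | var x => to_nat (0, x)
  | tzero => to_nat (1, 0)
  | tone => to_nat (2, 0)
  | tadd s t => to_nat (3, to_nat (code_tm s, code_tm t))
  | tmul s t => to_nat (4, to_nat (code_tm s, code_tm t))
  end.

Fixpoint code_fm (A : fm) : nat :=
  match A with
  | fEq s t => to_nat (0, to_nat (code_tm s, code_tm t))
  | fLt s t => to_nat (1, to_nat (code_tm s, code_tm t))
  | fIn t X => to_nat (2, to_nat (code_tm t, X))
  | fBot => to_nat (3, 0)
  | fImp A B => to_nat (4, to_nat (code_fm A, code_fm B))
  | fAllN A => to_nat (5, code_fm A)
  | fAllS A => to_nat (6, code_fm A)
  end.

Lemma to_nat_eq a b c d : to_nat (a, b) = to_nat (c, d) -> a = c /\ b = d.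
Proof. intros H. apply to_nat_inj in H. injection H; auto. Qed.

Ltac to_nat_split :=
  repeat match goal with
  | H : to_nat _ = to_nat _ |- _ => apply to_nat_eq in H as [? ?]; try discriminate
  end.

Lemma code_tm_inj s : forall t, code_tm s = code_tm t -> s = t.
Proof.
  induction s; intros []; cbn -[to_nat]; intros H; to_nat_split; f_equal; auto.
Qed.

Lemma code_fm_inj A : forall B, code_fm A = code_fm B -> A = B.
Proof.
  induction A; intros []; cbn -[to_nat]; intros H; to_nat_split; f_equal;
    auto using code_tm_inj.
Qed.

Section Henkin.

Context (T : fm -> Prop) (HT : subst_closed T) (G0 : list fm).

Definition consistent (G : list fm) : Prop := ~ prv T G fBot.

Context (H0 : consistent G0).

(** A left inverse of the injective [code_fm], so every formula occurs in the enumeration; a number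
    that codes nothing yields an arbitrary formula. *)
Definition fm_of (n : nat) : fm := epsilon (inhabits fBot) (fun A => code_fm A = n).

Lemma fm_of_code A : fm_of (code_fm A) = A.
Proof.
  apply code_fm_inj. apply (epsilon_spec (inhabits fBot) (fun B => code_fm B = code_fm A)).
  exists A; reflexivity.
Qed.

Definition fresh_num_for (G : list fm) : nat := list_sum (map bound_num G).
Definition fresh_set_for (G : list fm) : nat := list_sum (map bound_set G).

Lemma fresh_num_forP G : Forall (fresh_num (fresh_num_for G)) G.
Proof.
  apply Forall_forall. unfold fresh_num, fresh_num_for.
  induction G as [|B G IH]; simpl; [tauto|]. intros A [->|HA]; [lia|].
  specialize (IH A HA). unfold list_sum in *. lia.
Qed.

Lemma fresh_set_forP G : Forall (fresh_set (fresh_set_for G)) G.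
Proof.
  apply Forall_forall. unfold fresh_set, fresh_set_for.
  induction G as [|B G IH]; simpl; [tauto|]. intros A [->|HA]; [lia|].
  specialize (IH A HA). unfold list_sum in *. lia.
Qed.

(** Henkin witnesses are variables of the language itself: every stage is a finite list, so a
    variable beyond all of its variables is always left. *)
Definition counterexample (G : list fm) (A : fm) : list fm :=
  match A with
  | fAllN B => fNeg (instN B (var (fresh_num_for (A :: G)))) :: G
  | fAllS B => fNeg (instS B (fresh_set_for (A :: G))) :: G
  | _ => G
  end.

Definition step (G : list fm) (A : fm) : list fm :=
  if excluded_middle_informative (consistent (A :: G)) then A :: G
  else counterexample G A.

Lemma incl_step G A : incl G (step G A).
Proof.
  unfold step. destruct excluded_middle_informative; [intros C HC; right; exact HC|].
  destruct A; simpl; intros C HC; simpl; auto.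
Qed.

(** If the witness caused an inconsistency, [G] would prove the instance at a fresh variable, hence
    the universal formula, which [G] refutes because [A] was rejected. *)
Lemma consistent_step G A : consistent G -> consistent (step G A).
Proof.
  intros HG. unfold step. destruct excluded_middle_informative as [|Hn]; [assumption|].
  apply NNPP in Hn. intros Hbot. apply HG.
  apply prv_impE with (A := A); [apply prv_impI; exact Hn|].
  destruct A as [| | | | |A|A]; simpl in Hbot; try (apply prv_exfalso; exact Hbot).
  - apply prv_allNI_fresh with (y := fresh_num_for (fAllN A :: G)); [assumption|..].
    + exact (Forall_inv_tail (fresh_num_forP (fAllN A :: G))).
    + exact (Forall_inv (fresh_num_forP (fAllN A :: G))).
    + apply prv_dne, prv_impI. exact Hbot.
  - apply prv_allSI_fresh with (Y := fresh_set_for (fAllS A :: G)); [assumption|..].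
    + exact (Forall_inv_tail (fresh_set_forP (fAllS A :: G))).
    + exact (Forall_inv (fresh_set_forP (fAllS A :: G))).
    + apply prv_dne, prv_impI. exact Hbot.
Qed.

Fixpoint stage (n : nat) : list fm :=
  match n with
  | O => G0
  | S n => step (stage n) (fm_of n)
  end.

Lemma incl_stage m n : m <= n -> incl (stage m) (stage n).
Proof.
  induction 1 as [|n _ IH]; [apply incl_refl|].
  eapply incl_tran; [exact IH|apply incl_step].
Qed.

Lemma consistent_stage n : consistent (stage n).
Proof. induction n; [exact H0|apply consistent_step; assumption]. Qed.

Definition henkin (A : fm) : Prop := exists n, prv T (stage n) A.

Lemma henkin_prv G A : Forall henkin G -> prv T G A -> henkin A.
Proof.
  revert A; induction G as [|B G IH]; intros A HG HA.
  - exists 0. apply (prv_weak _ _ _ HA). intros C [].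
  - inversion HG as [|? ? [n Hn] HG']; subst.
    destruct (IH (fImp B A) HG' (prv_impI _ _ _ _ HA)) as [m Hm].
    exists (n + m). apply prv_impE with (A := B).
    + apply (prv_weak _ _ _ Hm), incl_stage; lia.
    + apply (prv_weak _ _ _ Hn), incl_stage; lia.
Qed.

Lemma henkin_bot : ~ henkin fBot.
Proof. intros [n Hn]. exact (consistent_stage n Hn). Qed.

(** Each formula is decided at the stage numbered by its own code. The second disjunct also records
    the next stage, from which the quantifier cases read off the witness. *)
Lemma henkin_step A : henkin A \/
  exists n, prv T (stage n) (fNeg A) /\ stage (S n) = counterexample (stage n) A.
Proof.
  set (n := code_fm A).
  assert (E : stage (S n) = step (stage n) A).
  { simpl. unfold n. rewrite fm_of_code. reflexivity. }
  unfold step in E. destruct excluded_middle_informative as [_|Hn].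
  - left. exists (S n). rewrite E. apply prv_hyp; left; reflexivity.
  - right. exists n. split; [|exact E]. apply prv_impI, NNPP, Hn.
Qed.

Lemma henkin_imp A B : henkin (fImp A B) <-> (henkin A -> henkin B).
Proof.
  split.
  - intros HAB HA. apply (henkin_prv [fImp A B; A]); [auto|].
    apply prv_impE with (A := A); apply prv_hyp; simpl; auto.
  - intros H. destruct (henkin_step A) as [HA|[n [HA _]]].
    + apply (henkin_prv [B]); [auto|]. apply prv_impI, prv_hyp; simpl; auto.
    + exists n. apply prv_impI, prv_exfalso. apply prv_impE with (A := A).
      * apply prv_weak_cons, HA.
      * apply prv_hyp; left; reflexivity.
Qed.

Lemma henkin_allN A : henkin (fAllN A) <-> forall t, henkin (instN A t).
Proof.
  split.
  - intros [n Hn] t. exists n. apply prv_allNE, Hn.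
  - intros H. destruct (henkin_step (fAllN A)) as [HA|[n [_ E]]]; [exact HA|exfalso].
    apply henkin_bot. simpl counterexample in E.
    set (B := instN A _) in E. apply (proj1 (henkin_imp B fBot)); [|apply H].
    exists (S n). rewrite E. apply prv_hyp; left; reflexivity.
Qed.

Lemma henkin_allS A : henkin (fAllS A) <-> forall X, henkin (instS A X).
Proof.
  split.
  - intros [n Hn] X. exists n. apply prv_allSE, Hn.
  - intros H. destruct (henkin_step (fAllS A)) as [HA|[n [_ E]]]; [exact HA|exfalso].
    apply henkin_bot. simpl counterexample in E.
    set (B := instS A _) in E. apply (proj1 (henkin_imp B fBot)); [|apply H].
    exists (S n). rewrite E. apply prv_hyp; left; reflexivity.
Qed.

Lemma henkin_refl t : henkin (fEq t t).
Proof. exists 0. apply prv_refl. Qed.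

Lemma henkin_leibniz A s t :
  henkin (fEq s t) -> henkin (instN A s) -> henkin (instN A t).
Proof.
  intros Hst Hs. apply (henkin_prv [fEq s t; instN A s]); [auto|].
  apply prv_leibniz with (s := s); apply prv_hyp; simpl; auto.
Qed.

Lemma henkin_sym s t : henkin (fEq s t) -> henkin (fEq t s).
Proof.
  intros H. apply (henkin_leibniz (fEq (var 0) (lift 1 s)) s t) in H;
    unfold instN in *; simpl in *; rewrite subst_tm_lift1, subst_tm_var in *.
  - exact H.
  - apply henkin_refl.
Qed.

Lemma henkin_trans s t u : henkin (fEq s t) -> henkin (fEq t u) -> henkin (fEq s u).
Proof.
  intros H1 H2. apply (henkin_leibniz (fEq (lift 1 s) (var 0)) t u) in H2;
    unfold instN in *; simpl in *; rewrite subst_tm_lift1, subst_tm_var in *; assumption.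
Qed.

(** Provably equal terms are equal to the same terms, so choice picks the same element for them. The
    fixed points of [rep] then serve as the quotient of terms by provable equality. *)
Definition rep (t : tm) : tm := epsilon (inhabits tzero) (fun s => henkin (fEq t s)).

Lemma henkin_rep t : henkin (fEq t (rep t)).
Proof.
  apply (epsilon_spec (inhabits tzero) (fun s => henkin (fEq t s))).
  exists t. apply henkin_refl.
Qed.

Lemma rep_eq s t : rep s = rep t <-> henkin (fEq s t).
Proof.
  split; intros H.
  - apply henkin_trans with (rep s); [apply henkin_rep|].
    rewrite H. apply henkin_sym, henkin_rep.
  - unfold rep. f_equal. extensionality u. apply propositional_extensionality.
    split; intros H'; eauto using henkin_trans, henkin_sym.
Qed.

Definition term_class : Type := {t : tm | rep t = t}.

Definition cls (t : tm) : term_class :=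
  exist _ (rep t) (proj2 (rep_eq (rep t) t) (henkin_sym _ _ (henkin_rep t))).

Lemma cls_eq s t : cls s = cls t <-> henkin (fEq s t).
Proof.
  rewrite <- rep_eq. split; intros H.
  - exact (f_equal (@proj1_sig _ _) H).
  - apply subset_eq_compat, H.
Qed.

Lemma cls_proj (a : term_class) : cls (proj1_sig a) = a.
Proof. destruct a as [t Ht]. apply subset_eq_compat, Ht. Qed.

(** Set variables are the only set terms and the language has no equality of sets, so the sort of
    sets needs no quotient. *)
Definition term_structure : structure := {|
  num := term_class;
  sets := nat;
  zero := cls tzero;
  one := cls tone;
  add a b := cls (tadd (proj1_sig a) (proj1_sig b));
  mul a b := cls (tmul (proj1_sig a) (proj1_sig b));
  lt a b := henkin (fLt (proj1_sig a) (proj1_sig b));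
  mem a X := henkin (fIn (proj1_sig a) X) |}.

Lemma henkin_congr A s : henkin (instN A (rep s)) <-> henkin (instN A s).
Proof.
  split; apply henkin_leibniz; [apply henkin_sym|]; apply henkin_rep.
Qed.

Ltac inst_simpl := unfold instN; simpl; rewrite ?subst_tm_lift1, ?subst_tm_var.

(** Leibniz replaces one argument at a time, starting from reflexivity at [tadd s t]. *)
Lemma henkin_add_rep s t : henkin (fEq (tadd (rep s) (rep t)) (tadd s t)).
Proof.
  generalize (proj2 (henkin_congr
    (fEq (tadd (var 0) (lift 1 (rep t))) (tadd (lift 1 s) (lift 1 t))) s)).
  generalize (proj2 (henkin_congr
    (fEq (tadd (lift 1 s) (var 0)) (tadd (lift 1 s) (lift 1 t))) t)).
  inst_simpl. auto using henkin_refl.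
Qed.

Lemma henkin_mul_rep s t : henkin (fEq (tmul (rep s) (rep t)) (tmul s t)).
Proof.
  generalize (proj2 (henkin_congr
    (fEq (tmul (var 0) (lift 1 (rep t))) (tmul (lift 1 s) (lift 1 t))) s)).
  generalize (proj2 (henkin_congr
    (fEq (tmul (lift 1 s) (var 0)) (tmul (lift 1 s) (lift 1 t))) t)).
  inst_simpl. auto using henkin_refl.
Qed.

Lemma eval_term_structure f t :
  eval term_structure (fun x => cls (f x)) t = cls (subst_tm f t).
Proof.
  induction t as [x| | |s IHs t IHt|s IHs t IHt]; try reflexivity.
  - simpl eval. rewrite IHs, IHt. apply cls_eq, henkin_add_rep.
  - simpl eval. rewrite IHs, IHt. apply cls_eq, henkin_mul_rep.
Qed.

(** The truth lemma, generalized over substitutions for the quantifier cases: every number of the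
    model is the class of a term. *)
Lemma sat_term_structure A : forall f r,
  sat term_structure (fun x => cls (f x)) r A <-> henkin (subst f r A).
Proof.
  induction A as [s t|s t|t X| |A IHA B IHB|A IH|A IH]; intros f r; simpl.
  - rewrite !eval_term_structure. apply cls_eq.
  - rewrite !eval_term_structure. simpl.
    generalize (henkin_congr (fLt (var 0) (lift 1 (rep (subst_tm f t)))) (subst_tm f s)).
    generalize (henkin_congr (fLt (lift 1 (subst_tm f s)) (var 0)) (subst_tm f t)).
    inst_simpl. tauto.
  - rewrite !eval_term_structure. exact (henkin_congr (fIn (var 0) (r X)) (subst_tm f t)).
  - split; [tauto|apply henkin_bot].
  - rewrite henkin_imp, IHA, IHB. reflexivity.
  - rewrite henkin_allN. fold (up f).
    assert (Hs : forall t, scons (cls t) (fun x => cls (f x)) = fun x => cls (scons t f x)).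
    { intros t. extensionality x. destruct x; reflexivity. }
    split.
    + intros H t. rewrite instN_subst_up, <- IH, <- Hs. apply H.
    + intros H a. rewrite <- (cls_proj a), Hs, IH, <- instN_subst_up. apply H.
  - rewrite henkin_allS. split.
    + intros H X. rewrite instS_subst_up, <- IH. apply H.
    + intros H X. rewrite IH, <- instS_subst_up. apply H.
Qed.

Lemma term_structure_models : models term_structure T.
Proof.
  intros A HA e q. replace e with (fun x => cls (proj1_sig (e x))).
  - apply sat_term_structure. exists 0. apply prv_ax, HT, HA.
  - extensionality x. apply cls_proj.
Qed.

Lemma term_structure_G0 A : In A G0 -> sat term_structure (fun x => cls (var x)) idr A.
Proof.
  intros HA. apply sat_term_structure. rewrite subst_var. exists 0. apply prv_hyp, HA.
Qed.

End Henkin.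

(** Otherwise [fNeg A] is consistent with [T], and the term structure built from it is a model of
    [T] in which [A] fails. *)
Theorem completeness T A : subst_closed T ->
  (forall M, models M T -> forall e q, sat M e q A) -> proves T A.
Proof.
  intros HT H. apply prv_dne, prv_impI. apply NNPP. intros Hcon.
  apply (term_structure_G0 T HT [fNeg A] Hcon (fNeg A)); [left; reflexivity|].
  apply H. apply term_structure_models; assumption.
Qed.
(** * Definability in models of RCA_0 *)

Lemma bounded_subst A : bounded A -> forall f r, bounded (subst f r A).
Proof.
  induction 1 as [| | | | |t A _ IH]; intros f r; simpl; try (constructor; auto).
  fold (up f). rewrite subst_tm_lift1.
  replace (subst_tm (fun x => up f (S x)) t) with (lift 1 (subst_tm f t)).
  - constructor; auto.
  - apply subst_tm_comp.
Qed.

Lemma subst_succ_inst f r A :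
  subst (up f) r (succ_inst A) = succ_inst (subst (up f) r A).
Proof.
  unfold succ_inst. rewrite !subst_comp. f_equal.
  extensionality x. destruct x as [|x]; simpl; [reflexivity|].
  symmetry. apply subst_tm_lift1.
Qed.

Lemma subst_induction f r A : subst f r (induction A) = induction (subst (up f) r A).
Proof.
  unfold induction, fAnd, fNeg. rewrite <- subst_succ_inst.
  change tzero with (subst_tm f tzero) at 2. rewrite <- subst_instN. reflexivity.
Qed.

Lemma subst_delta_comprehension f r A B :
  subst f r (delta_comprehension A B) =
  delta_comprehension (subst (up f) r A) (subst (up f) r B).
Proof.
  unfold delta_comprehension. rewrite <- subst_shiftS. reflexivity.
Qed.

(** The basic axioms are sentences; substitution commutes with both schemes and preserves
    boundedness. *)
Lemma RCA0_subst : subst_closed RCA0.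
Proof.
  intros _ f r [A HA|_ [A HA]|_ _ [A HA] [B HB]].
  - apply RCA0_basic. destruct HA; constructor.
  - rewrite subst_induction. apply RCA0_induction. constructor. apply bounded_subst, HA.
  - rewrite subst_delta_comprehension.
    apply RCA0_comprehension; constructor; apply bounded_subst; assumption.
Qed.

Lemma forall_iff {T : Type} (P Q : T -> Prop) :
  (forall x, P x <-> Q x) -> (forall x, P x) <-> (forall x, Q x).
Proof. firstorder. Qed.

Lemma exists_iff {T : Type} (P Q : T -> Prop) :
  (forall x, P x <-> Q x) -> (exists x, P x) <-> (exists x, Q x).
Proof. firstorder. Qed.

Section Model.

(** [X0] is the default value for set environments of formulas that mention no set. *)
Context (M : structure) (X0 : sets M).

Lemma eval_subst e f t : eval M e (subst_tm f t) = eval M (fun x => eval M e (f x)) t.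
Proof. induction t; simpl; congruence. Qed.

Lemma eval_lift k e t : eval M e (lift k t) = eval M (fun x => e (k + x)) t.
Proof. apply eval_subst. Qed.

Lemma eval_lift1 a e t : eval M (scons a e) (lift 1 t) = eval M e t.
Proof. apply eval_subst. Qed.

Lemma sat_subst A : forall e q f r,
  sat M e q (subst f r A) <-> sat M (fun x => eval M e (f x)) (fun X => q (r X)) A.
Proof.
  induction A as [s t|s t|t X| |A IHA B IHB|A IH|A IH]; intros e q f r; simpl;
    rewrite ?eval_subst; try reflexivity.
  - rewrite IHA, IHB. reflexivity.
  - apply forall_iff. intros a. rewrite IH. fold (up f).
    replace (fun x => eval M (scons a e) (up f x)) with (scons a (fun x => eval M e (f x)));
      [reflexivity|].
    extensionality x. destruct x; [reflexivity|]. symmetry. apply eval_lift1.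
  - apply forall_iff. intros X. rewrite IH.
    replace (fun Y => scons X q (scons 0 (fun Z => S (r Z)) Y))
      with (scons X (fun Y => q (r Y))); [reflexivity|].
    extensionality Y. destruct Y; reflexivity.
Qed.

Lemma sat_instN e q A t : sat M e q (instN A t) <-> sat M (scons (eval M e t) e) q A.
Proof.
  unfold instN. rewrite sat_subst.
  replace (fun x => eval M e (scons t var x)) with (scons (eval M e t) e); [reflexivity|].
  extensionality x. destruct x; reflexivity.
Qed.

Lemma sat_succ_inst x e q A :
  sat M (scons x e) q (succ_inst A) <-> sat M (scons (add M x (one M)) e) q A.
Proof.
  unfold succ_inst. rewrite sat_subst.
  replace (fun y => eval M (scons x e) (scons (var 0 + 1)%tm (fun z => var (S z)) y))
    with (scons (add M x (one M)) e); [reflexivity|].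
  extensionality y. destruct y; reflexivity.
Qed.

Lemma sat_shiftS X e q A : sat M e (scons X q) (shiftS A) <-> sat M e q A.
Proof. exact (sat_subst A e (scons X q) var S). Qed.

Lemma sat_and e q A B : sat M e q (fAnd A B) <-> sat M e q A /\ sat M e q B.
Proof. simpl. split; [|tauto]. intros H; split; apply NNPP; tauto. Qed.

Lemma sat_or e q A B : sat M e q (fOr A B) <-> sat M e q A \/ sat M e q B.
Proof. simpl. split; [|tauto]. intros H; apply NNPP; tauto. Qed.

Lemma sat_iff e q A B : sat M e q (fIff A B) <-> (sat M e q A <-> sat M e q B).
Proof. unfold fIff. rewrite sat_and. reflexivity. Qed.

Lemma sat_exN e q A : sat M e q (fExN A) <-> exists a, sat M (scons a e) q A.
Proof.
  simpl. split; [|firstorder]. intros H. apply NNPP. intros Hn. apply H.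
  intros a Ha. apply Hn. exists a; exact Ha.
Qed.

Lemma sat_exS e q A : sat M e q (fExS A) <-> exists X, sat M e (scons X q) A.
Proof.
  simpl. split; [|firstorder]. intros H. apply NNPP. intros Hn. apply H.
  intros a Ha. apply Hn. exists a; exact Ha.
Qed.

(** * Bounded definability with parameters *)

Definition env : Type := nat -> num M.

(* [inl j] stands for the [j]-th variable and [inr a] for the parameter [a]. *)
Definition look (v : nat -> nat + num M) (e : env) (i : nat) : num M :=
  match v i with inl j => e j | inr a => a end.

Definition term_def (t : env -> num M) : Prop :=
  exists s v, forall e, eval M (look v e) s = t e.

(** Number parameters sit in [v] and set parameters in [q]. Since this is a property of predicates,
    the tactic [delta0] can follow the shape of a Rocq proposition. *)
Definition delta0 (P : env -> Prop) : Prop :=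
  exists A v q, bounded A /\ forall e, sat M (look v e) q A <-> P e.

(** Interleaving lets two formulas with unrelated parameters share one environment: the first reads
    the even variables, the second the odd ones. *)
Definition join {T : Type} (v w : nat -> T) (i : nat) : T :=
  if Nat.even i then v (Nat.div2 i) else w (Nat.div2 i).

Lemma join_l {T : Type} (v w : nat -> T) i : join v w (2 * i) = v i.
Proof. unfold join. rewrite Nat.even_even, Nat.div2_double. reflexivity. Qed.

Lemma join_r {T : Type} (v w : nat -> T) i : join v w (S (2 * i)) = w i.
Proof.
  unfold join. rewrite Nat.even_succ, <- Nat.negb_even, Nat.even_even.
  rewrite Nat.div2_succ_double. reflexivity.
Qed.

Lemma look_join_l v w e : (fun i => look (join v w) e (2 * i)) = look v e.
Proof. extensionality i. unfold look. rewrite join_l. reflexivity. Qed.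

Lemma look_join_r v w e : (fun i => look (join v w) e (S (2 * i))) = look w e.
Proof. extensionality i. unfold look. rewrite join_r. reflexivity. Qed.

Definition left_tm (i : nat) : tm := var (2 * i).
Definition right_tm (i : nat) : tm := var (S (2 * i)).

Lemma eval_join_l v w e t : eval M (look (join v w) e) (subst_tm left_tm t) = eval M (look v e) t.
Proof. rewrite eval_subst, <- (look_join_l v w). reflexivity. Qed.

Lemma eval_join_r v w e t : eval M (look (join v w) e) (subst_tm right_tm t) = eval M (look w e) t.
Proof. rewrite eval_subst, <- (look_join_r v w). reflexivity. Qed.

Lemma sat_join_l v w e q r A :
  sat M (look (join v w) e) (join q r) (subst left_tm (fun X => 2 * X) A) <->
  sat M (look v e) q A.
Proof.
  rewrite sat_subst, <- (look_join_l v w).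
  replace (fun X => join q r (2 * X)) with q; [reflexivity|].
  extensionality X. symmetry. apply join_l.
Qed.

Lemma sat_join_r v w e q r A :
  sat M (look (join v w) e) (join q r) (subst right_tm (fun X => S (2 * X)) A) <->
  sat M (look w e) r A.
Proof.
  rewrite sat_subst, <- (look_join_r v w).
  replace (fun X => join q r (S (2 * X))) with r; [reflexivity|].
  extensionality X. symmetry. apply join_r.
Qed.

Lemma term_def_pair s t : term_def s -> term_def t ->
  exists a b v, forall e, eval M (look v e) a = s e /\ eval M (look v e) b = t e.
Proof.
  intros (a & v & Ha) (b & w & Hb).
  exists (subst_tm left_tm a), (subst_tm right_tm b), (join v w). intros e.
  rewrite eval_join_l, eval_join_r. auto.
Qed.

Lemma delta0_pair P Q : delta0 P -> delta0 Q ->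
  exists A B v q, bounded A /\ bounded B /\
    forall e, (sat M (look v e) q A <-> P e) /\ (sat M (look v e) q B <-> Q e).
Proof.
  intros (A & v & q & HA & HP) (B & w & r & HB & HQ).
  exists (subst left_tm (fun X => 2 * X) A), (subst right_tm (fun X => S (2 * X)) B).
  exists (join v w), (join q r).
  split; [apply bounded_subst, HA|]. split; [apply bounded_subst, HB|].
  intros e. rewrite sat_join_l, sat_join_r. auto.
Qed.

Lemma term_def_var n : term_def (fun e => e n).
Proof. exists (var n), (fun i => inl i). reflexivity. Qed.

Lemma term_def_const a : term_def (fun _ => a).
Proof. exists (var 0), (fun _ => inr a). reflexivity. Qed.

Lemma term_def_add s t : term_def s -> term_def t -> term_def (fun e => add M (s e) (t e)).
Proof.
  intros Hs Ht. destruct (term_def_pair s t Hs Ht) as (a & b & v & H).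
  exists (a + b)%tm, v. intros e. destruct (H e) as [<- <-]. reflexivity.
Qed.

Lemma term_def_mul s t : term_def s -> term_def t -> term_def (fun e => mul M (s e) (t e)).
Proof.
  intros Hs Ht. destruct (term_def_pair s t Hs Ht) as (a & b & v & H).
  exists (a * b)%tm, v. intros e. destruct (H e) as [<- <-]. reflexivity.
Qed.

Lemma term_def_rename t (h : nat -> nat) :
  term_def t -> term_def (fun e => t (fun n => e (h n))).
Proof.
  intros (s & v & Hs).
  exists s, (fun i => match v i with inl j => inl (h j) | c => c end).
  intros e. rewrite <- Hs. f_equal. extensionality i. unfold look. destruct (v i); reflexivity.
Qed.

Lemma delta0_ext P Q : (forall e, P e <-> Q e) -> delta0 P -> delta0 Q.
Proof.
  intros H (A & v & q & HA & HP). exists A, v, q. split; [exact HA|].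
  intros e. rewrite HP. apply H.
Qed.

Lemma delta0_imp P Q : delta0 P -> delta0 Q -> delta0 (fun e => P e -> Q e).
Proof.
  intros HP HQ. destruct (delta0_pair P Q HP HQ) as (A & B & v & q & HA & HB & H).
  exists (fImp A B), v, q. split; [constructor; assumption|].
  intros e. destruct (H e) as [<- <-]. reflexivity.
Qed.

Lemma delta0_all t P : term_def t -> delta0 (fun e => P (fun n => e (S n)) (e 0)) ->
  delta0 (fun e => forall x, lt M x (t e) -> P e x).
Proof.
  intros (s & v & Hs) (A & w & q & HA & HP).
  (* [w'] is the layout outside the quantifier, hence the decrement. [f] sends the variables that
     stand for entry 0 to the bound variable, and any other [i] to its odd position under [join],
     raised by one for the binder. *)
  set (w' := fun i => match w i with inl (S j) => inl j | c => c end).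
  set (f := fun i => match w i with inl 0 => var 0 | _ => var (S (S (2 * i))) end).
  exists (fAllN (var 0 < lift 1 (subst_tm left_tm s) ⟶ subst f idr A)), (join v w'), q.
  split; [constructor; apply bounded_subst, HA|]. intros e. simpl.
  apply forall_iff. intros x.
  rewrite eval_lift1, eval_join_l, Hs, sat_subst.
  replace (fun i => eval M (scons x (look (join v w') e)) (f i)) with (look w (scons x e)).
  - unfold idr. specialize (HP (scons x e)). simpl in HP. rewrite <- HP. reflexivity.
  - extensionality i.
    assert (E : look (join v w') e (S (2 * i)) = look w' e i)
      by (unfold look; rewrite join_r; reflexivity).
    unfold f, look at 1. destruct (w i) as [[|j]|a] eqn:Ew; [reflexivity|..];
      change (eval M (scons x (look (join v w') e)) (var (S (S (2 * i)))))
        with (look (join v w') e (S (2 * i))); rewrite E; unfold look, w'; rewrite Ew; reflexivity.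
Qed.

Lemma delta0_eq s t : term_def s -> term_def t -> delta0 (fun e => s e = t e).
Proof.
  intros Hs Ht. destruct (term_def_pair s t Hs Ht) as (a & b & v & H).
  exists (fEq a b), v, (fun _ => X0). split; [constructor|].
  intros e. simpl. destruct (H e) as [-> ->]. reflexivity.
Qed.

Lemma delta0_lt s t : term_def s -> term_def t -> delta0 (fun e => lt M (s e) (t e)).
Proof.
  intros Hs Ht. destruct (term_def_pair s t Hs Ht) as (a & b & v & H).
  exists (fLt a b), v, (fun _ => X0). split; [constructor|].
  intros e. simpl. destruct (H e) as [-> ->]. reflexivity.
Qed.

Lemma delta0_mem t X : term_def t -> delta0 (fun e => mem M (t e) X).
Proof.
  intros (a & v & H). exists (fIn a 0), v, (fun _ => X). split; [constructor|].
  intros e. simpl. rewrite H. reflexivity.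
Qed.

(** A proposition that does not depend on the environment has a fixed truth value, so a true or a
    false formula defines it. *)
Lemma delta0_const (P : Prop) : delta0 (fun _ => P).
Proof.
  destruct (classic P) as [HP|HP].
  - apply delta0_ext with (fun _ => zero M = zero M); [tauto|].
    apply delta0_eq; apply term_def_const.
  - exists fBot, (fun _ => inl 0), (fun _ => X0). split; [constructor|]. simpl. tauto.
Qed.

Lemma delta0_not P : delta0 P -> delta0 (fun e => ~ P e).
Proof. intros HP. exact (delta0_imp _ _ HP (delta0_const False)). Qed.

Lemma delta0_and P Q : delta0 P -> delta0 Q -> delta0 (fun e => P e /\ Q e).
Proof.
  intros HP HQ. apply delta0_ext with (fun e => ~ (P e -> ~ Q e)).
  - intros e. tauto.
  - auto using delta0_not, delta0_imp.
Qed.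

Lemma delta0_or P Q : delta0 P -> delta0 Q -> delta0 (fun e => P e \/ Q e).
Proof.
  intros HP HQ. apply delta0_ext with (fun e => ~ P e -> Q e).
  - intros e. tauto.
  - auto using delta0_not, delta0_imp.
Qed.

Lemma delta0_iff P Q : delta0 P -> delta0 Q -> delta0 (fun e => P e <-> Q e).
Proof. intros HP HQ. apply delta0_and; apply delta0_imp; assumption. Qed.

Lemma delta0_ex t P : term_def t -> delta0 (fun e => P (fun n => e (S n)) (e 0)) ->
  delta0 (fun e => exists x, lt M x (t e) /\ P e x).
Proof.
  intros Ht HP. apply delta0_ext with (fun e => ~ forall x, lt M x (t e) -> ~ P e x).
  - intros e. split; [|firstorder]. intros H. apply NNPP. firstorder.
  - apply delta0_not, delta0_all; [exact Ht|]. apply delta0_not, HP.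
Qed.

(** The schemes want the witness as variable 0, the argument as variable 1 and all else as
    parameters. Entries from 2 on are frozen at zero, and both formulas share one environment, as
    comprehension requires. *)
Lemma delta0_layout P Q : delta0 P -> delta0 Q ->
  exists A B p q, bounded A /\ bounded B /\ forall y x,
    (sat M (scons y (scons x p)) q A <-> P (scons y (scons x (fun _ => zero M)))) /\
    (sat M (scons y (scons x p)) q B <-> Q (scons y (scons x (fun _ => zero M)))).
Proof.
  intros HP HQ. destruct (delta0_pair P Q HP HQ) as (A & B & v & q & HA & HB & H).
  set (f := fun i => match v i with inl 0 => var 0 | inl 1 => var 1 | _ => var (S (S i)) end).
  set (p := fun i => match v i with inl _ => zero M | inr a => a end).
  exists (subst f idr A), (subst f idr B), p, q.
  split; [apply bounded_subst, HA|]. split; [apply bounded_subst, HB|]. intros y x.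
  rewrite !sat_subst.
  replace (fun i => eval M (scons y (scons x p)) (f i))
    with (look v (scons y (scons x (fun _ => zero M)))); [apply H|].
  extensionality i. unfold f, look.
  destruct (v i) as [[|[|j]]|a] eqn:E; try reflexivity;
    unfold p; simpl; rewrite E; reflexivity.
Qed.

(** * The induction and comprehension schemes for definable predicates *)

Context (HM : models M RCA0).

Lemma sigma1_induction (R : num M -> num M -> Prop) :
  delta0 (fun e => R (e 0) (e 1)) ->
  (exists y, R y (zero M)) ->
  (forall x, (exists y, R y x) -> exists y, R y (add M x (one M))) ->
  forall x, exists y, R y x.
Proof.
  intros HR H0 HS. destruct (delta0_layout _ _ HR HR) as (A & B & p & q & HA & _ & H).
  assert (E : forall x, sat M (scons x p) q (fExN A) <-> exists y, R y x).
  { intros x. rewrite sat_exN. split; intros [y Hy]; exists y; apply (proj1 (H y x)), Hy. }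
  pose proof (HM _ (RCA0_induction _ (Sigma01_intro A HA)) p q) as Hind.
  intros x. apply E. revert x. apply Hind. clear Hind.
  rewrite sat_and. split.
  - rewrite sat_instN. apply E, H0.
  - intros x Hx. apply sat_succ_inst, E, HS, E, Hx.
Qed.

Lemma delta0_induction (P : num M -> Prop) :
  delta0 (fun e => P (e 0)) ->
  P (zero M) -> (forall x, P x -> P (add M x (one M))) -> forall x, P x.
Proof.
  intros HP H0 HS x.
  destruct (sigma1_induction (fun _ => P)) with (x := x) as [_ H]; auto.
  - destruct HP as (A & v & q & HA & H).
    exists A, (fun i => match v i with inl j => inl (S j) | c => c end), q.
    split; [exact HA|]. intros e. rewrite <- (H (fun n => e (S n))).
    replace (look _ e) with (look v (fun n => e (S n))); [reflexivity|].
    extensionality i. unfold look. destruct (v i); reflexivity.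
  - exists (zero M). exact H0.
  - intros y [_ Hy]. exists (zero M). auto.
Qed.

Lemma delta1_comprehension (R Q : num M -> num M -> Prop) :
  delta0 (fun e => R (e 0) (e 1)) -> delta0 (fun e => Q (e 0) (e 1)) ->
  (forall x, (exists y, R y x) <-> (forall y, Q y x)) ->
  exists X, forall x, mem M x X <-> exists y, R y x.
Proof.
  intros HR HQ HRQ. destruct (delta0_layout _ _ HR HQ) as (A & B & p & q & HA & HB & H).
  assert (E : forall x, sat M (scons x p) q (fExN A) <-> exists y, R y x).
  { intros x. rewrite sat_exN. split; intros [y Hy]; exists y; apply (proj1 (H y x)), Hy. }
  pose proof (HM _ (RCA0_comprehension _ _ (Sigma01_intro A HA) (Pi01_intro B HB)) p q) as Hc.
  apply sat_exS in Hc as [X HX].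
  - exists X. intros x. rewrite <- E. specialize (HX x). rewrite sat_iff, sat_shiftS in HX.
    exact HX.
  - intros x. rewrite sat_iff, E, HRQ. apply forall_iff. intros y. symmetry. exact (proj2 (H y x)).
Qed.

(** * Arithmetic in models of RCA_0 *)

Declare Scope model_scope.
Local Notation "0" := (zero M) : model_scope.
Local Notation "1" := (one M) : model_scope.
Local Infix "+" := (add M) : model_scope.
Local Infix "*" := (mul M) : model_scope.
Local Infix "<" := (lt M) : model_scope.
Local Open Scope model_scope.
Local Notation N := (num M).

Lemma basic_sat A : basic A -> sat M (fun _ => 0) (fun _ => X0) A.
Proof. intros HA. apply HM, RCA0_basic, HA. Qed.

Lemma succ_neq0 x : x + 1 <> 0.
Proof. exact (basic_sat _ basic_succ_neq0 x). Qed.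

Lemma succ_inj x y : x + 1 = y + 1 -> x = y.
Proof. exact (basic_sat _ basic_succ_inj x y). Qed.

Lemma addn0 x : x + 0 = x.
Proof. exact (basic_sat _ basic_add0 x). Qed.

Lemma addnS x y : x + (y + 1) = (x + y) + 1.
Proof. exact (basic_sat _ basic_addS x y). Qed.

Lemma muln0 x : x * 0 = 0.
Proof. exact (basic_sat _ basic_mul0 x). Qed.

Lemma mulnS x y : x * (y + 1) = x * y + x.
Proof. exact (basic_sat _ basic_mulS x y). Qed.

Lemma ltn0 x : ~ x < 0.
Proof. exact (basic_sat _ basic_lt0 x). Qed.

Lemma ltnS x y : x < y + 1 <-> x < y \/ x = y.
Proof. generalize (basic_sat _ basic_ltS x y). rewrite sat_iff, sat_or. auto. Qed.

(** A bounded quantifier over [x < t e + 1] with [x = t e] performs the substitution, so no formula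
    has to be rewritten. *)
Lemma delta0_comp P t : delta0 (fun e => P (e O)) -> term_def t -> delta0 (fun e => P (t e)).
Proof.
  intros HP Ht.
  apply delta0_ext with (fun e => exists x, x < t e + 1 /\ (x = t e /\ P x)).
  - intros e. split; [intros (x & _ & -> & Hx); exact Hx|].
    intros He. exists (t e). split; [apply ltnS; auto|auto].
  - apply (delta0_ex (fun e => t e + 1) (fun e x => x = t e /\ P x)).
    + apply term_def_add; [exact Ht|apply term_def_const].
    + apply delta0_and; [|exact HP].
      apply delta0_eq; [apply term_def_var|apply (term_def_rename t S Ht)].
Qed.

(** Redefined whenever further predicates have been shown to be bounded. *)
Ltac delta0_hook := fail.

Ltac term_def :=
  cbv beta;
  lazymatch goal with
  | |- term_def (fun _ => ?a) => apply (term_def_const a)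
  | |- term_def (fun e => add M (@?s e) (@?t e)) => apply (term_def_add s t); term_def
  | |- term_def (fun e => mul M (@?s e) (@?t e)) => apply (term_def_mul s t); term_def
  | |- term_def (fun e => e ?n) => apply (term_def_var n)
  | |- term_def (fun e => ?t (fun n => e (@?h n))) => apply (term_def_rename t h); assumption
  | |- _ => assumption
  end.

Ltac delta0 :=
  cbv beta;
  lazymatch goal with
  | |- delta0 (fun _ => ?P) => apply (delta0_const P)
  | |- delta0 (fun e => @?s e = @?t e) => apply (delta0_eq s t); term_def
  | |- delta0 (fun e => lt M (@?s e) (@?t e)) => apply (delta0_lt s t); term_def
  | |- delta0 (fun e => mem M (@?s e) ?X) => apply (delta0_mem s X); term_def
  | |- delta0 (fun e => forall x, lt M x (@?t e) -> @?P e x) =>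
      apply (delta0_all t P); [term_def|delta0]
  | |- delta0 (fun e => exists x, lt M x (@?t e) /\ @?P e x) =>
      apply (delta0_ex t P); [term_def|delta0]
  | |- delta0 (fun e => @?P e /\ @?Q e) => apply (delta0_and P Q); delta0
  | |- delta0 (fun e => @?P e \/ @?Q e) => apply (delta0_or P Q); delta0
  | |- delta0 (fun e => @?P e <-> @?Q e) => apply (delta0_iff P Q); delta0
  | |- delta0 (fun e => ~ @?P e) => apply (delta0_not P); delta0
  | |- delta0 (fun e => @?P e -> @?Q e) => apply (delta0_imp P Q); delta0
  | H : delta0 (fun e => ?P (e O)) |- delta0 (fun e => ?P (@?t e)) =>
      apply (delta0_comp P t H); term_def
  | |- _ => delta0_hook
  end.

Ltac ind x := pattern x; apply delta0_induction; [delta0| |clear x; intros x IH].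

Lemma addnA x y z : x + (y + z) = x + y + z.
Proof.
  ind z; [rewrite !addn0; reflexivity|]. rewrite !addnS, IH. reflexivity.
Qed.

Lemma add0n x : 0 + x = x.
Proof. ind x; [apply addn0|]. rewrite addnS, IH. reflexivity. Qed.

Lemma addSn x y : (x + 1) + y = (x + y) + 1.
Proof. ind y; [rewrite !addn0; reflexivity|]. rewrite !addnS, IH. reflexivity. Qed.

Lemma addnC x y : x + y = y + x.
Proof.
  ind y; [rewrite addn0, add0n; reflexivity|]. rewrite addnS, addSn, IH. reflexivity.
Qed.

Lemma mul0n x : 0 * x = 0.
Proof. ind x; [apply muln0|]. rewrite mulnS, IH. apply addn0. Qed.

Lemma mulSn x y : (x + 1) * y = x * y + y.
Proof.
  ind y; [rewrite !muln0, addn0; reflexivity|].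
  rewrite !mulnS, IH, <- !addnA, (addnA y x 1), (addnC y x), <- addnA. reflexivity.
Qed.

Lemma mulnC x y : x * y = y * x.
Proof. ind y; [rewrite muln0, mul0n; reflexivity|]. rewrite mulnS, mulSn, IH. reflexivity. Qed.

Lemma mulnDr x y z : x * (y + z) = x * y + x * z.
Proof.
  ind z; [rewrite muln0, !addn0; reflexivity|].
  rewrite addnS, !mulnS, IH, addnA. reflexivity.
Qed.

Lemma mulnA x y z : x * (y * z) = x * y * z.
Proof.
  ind z; [rewrite !muln0; reflexivity|]. rewrite !mulnS, mulnDr, IH. reflexivity.
Qed.

Lemma mul1n x : 1 * x = x.
Proof. rewrite <- (add0n 1), mulSn, mul0n, add0n. reflexivity. Qed.

Lemma model_semi_ring : semi_ring_theory 0 1 (add M) (mul M) eq.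
Proof.
  constructor; intros; auto using add0n, addnC, addnA, mul1n, mul0n, mulnC, mulnA.
  rewrite mulnC, mulnDr, !(mulnC p). reflexivity.
Qed.

Add Ring model_ring : model_semi_ring.

Lemma addIn x y z : x + z = y + z -> x = y.
Proof.
  ind z; [rewrite !addn0; auto|]. rewrite !addnA. intros H. apply IH, succ_inj, H.
Qed.

Lemma zero_or_succ x : x = 0 \/ exists y, x = y + 1.
Proof.
  destruct (sigma1_induction (fun y x => x = 0 \/ x = y + 1)) with (x := x)
    as [y [Hy|Hy]].
  - delta0.
  - exists 0; auto.
  - intros y _. exists y. auto.
  - auto.
  - right. exists y. exact Hy.
Qed.

Lemma add_eq0 x y : x + y = 0 -> y = 0.
Proof.
  intros E. destruct (zero_or_succ y) as [->|[z ->]]; [reflexivity|].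
  destruct (succ_neq0 (x + z)). rewrite <- E. ring.
Qed.

Lemma lt_sum x y : x < y -> exists z, y = x + z + 1.
Proof.
  destruct (sigma1_induction (fun z y => x < y -> y = x + z + 1)) with (x := y)
    as [z Hz].
  - delta0.
  - exists 0. intros H. destruct (ltn0 x H).
  - intros u [z Hz]. destruct (classic (x < u)) as [H|H].
    + exists (z + 1). intros _. rewrite (Hz H) at 1. ring.
    + exists 0. intros Hu. apply ltnS in Hu as [Hu| ->]; [contradiction|ring].
  - intros H. exists z. exact (Hz H).
Qed.

Lemma lt_addS x z : x < x + z + 1.
Proof.
  ind z; apply ltnS; [right; symmetry; apply addn0|]. left. rewrite addnA. exact IH.
Qed.

Lemma lt_iff x y : x < y <-> exists z, y = x + z + 1.
Proof. split; [apply lt_sum|]. intros [z ->]. apply lt_addS. Qed.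

Lemma ltnn x : ~ x < x.
Proof.
  intros H. apply lt_sum in H as [z H]. apply (succ_neq0 z).
  apply (addIn _ _ x). rewrite add0n. rewrite H at 2. ring.
Qed.

Lemma lt_trans x y z : x < y -> y < z -> x < z.
Proof.
  rewrite !lt_iff. intros [u ->] [v ->]. exists (u + v + 1). ring.
Qed.

Lemma lt_total x y : x < y \/ x = y \/ y < x.
Proof.
  ind y.
  - destruct (zero_or_succ x) as [->|[z ->]]; [auto|].
    right; right. apply lt_iff. exists z. ring.
  - rewrite ltnS. destruct IH as [H|[->|H]]; auto.
    apply lt_sum in H as [z ->].
    destruct (zero_or_succ z) as [->|[u ->]]; [right; left; ring|].
    right; right. apply lt_iff. exists u. ring.
Qed.
(** From here on [x < y + 1] serves as the weak order. *)
Lemma ltS_iff x y : x < y + 1 <-> exists z, y = x + z.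
Proof.
  rewrite lt_iff. split; intros [z H]; exists z; [apply (addIn _ _ 1), H|].
  rewrite H. reflexivity.
Qed.

Lemma lt_leS x y z : x < y -> y < z + 1 -> x < z.
Proof. rewrite ltnS. intros Hxy [Hyz| <-]; [exact (lt_trans _ _ _ Hxy Hyz)|exact Hxy]. Qed.

Lemma leS_lt x y z : x < y + 1 -> y < z -> x < z.
Proof. rewrite ltnS. intros [Hxy| ->] Hyz; [exact (lt_trans _ _ _ Hxy Hyz)|exact Hyz]. Qed.

Lemma lt_addl x y z : x < y -> x < z + y.
Proof. intros H. apply (lt_leS _ _ _ H), ltS_iff. exists z. ring. Qed.

Lemma lt_addr x y z : x < y -> x < y + z.
Proof. rewrite addnC. apply lt_addl. Qed.

Lemma lt_ge_false x y : x < y -> y < x + 1 -> False.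
Proof. intros H1 H2. exact (ltnn x (lt_leS _ _ _ H1 H2)). Qed.

Lemma delta0_least (P : N -> Prop) c : delta0 (fun e => P (e O)) -> P c ->
  exists d, P d /\ forall x, P x -> ~ x < d.
Proof.
  intros HP Hc. apply NNPP. intros Hn.
  assert (H : forall x y, y < x -> ~ P y).
  { intros x. ind x.
    - intros y Hy. destruct (ltn0 y Hy).
    - intros y Hy. apply ltnS in Hy as [Hy| ->]; [exact (IH y Hy)|].
      intros Hx. apply Hn. exists x. split; [exact Hx|]. intros y Hy Hyx. exact (IH y Hyx Hy). }
  apply (H (c + 1) c); [apply ltnS; auto|exact Hc].
Qed.

(** * Codes of finite sets in models of RCA_0 *)

Definition dvd (a b : N) : Prop := exists z, b = a * z.

Lemma dvd_mulr a b c : dvd a b -> dvd a (b * c).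
Proof. intros [z ->]. exists (z * c). ring. Qed.

Lemma dvd_mull a b : dvd a (b * a).
Proof. exists b. ring. Qed.

(** There is no subtraction, so the quotients of [x] and [x + y] are compared; if the first is the
    larger one, then [y] is 0. *)
Lemma dvd_add_cancel a x y : dvd a (x + y) -> dvd a x -> dvd a y.
Proof.
  intros [q Hq] [p ->]. destruct (lt_total p q) as [H|[->|H]].
  - apply lt_sum in H as [z ->]. exists (z + 1). apply (addIn _ _ (a * p)).
    rewrite addnC, Hq. ring.
  - exists 0. apply (addIn _ _ (a * q)). rewrite addnC, Hq. ring.
  - apply lt_sum in H as [z ->]. exists 0. rewrite muln0. apply (add_eq0 (a * (z + 1))).
    apply (addIn _ _ (a * q)). rewrite add0n. etransitivity; [|exact Hq]. ring.
Qed.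

Lemma delta0_dvd s t : term_def s -> term_def t -> delta0 (fun e => dvd (s e) (t e)).
Proof.
  intros Hs Ht.
  apply delta0_ext with (fun e => exists z, z < t e + 1 /\ t e = s e * z).
  - intros e. split; [intros (z & _ & Hz); exists z; exact Hz|].
    (* A nonzero divisor has a quotient at most the dividend; for divisor 0 the dividend is 0 and
       quotient 0 will do. *)
    intros [z Hz]. destruct (zero_or_succ (s e)) as [E|[u E]]; rewrite Hz, E.
    + exists 0. split; [apply ltS_iff; exists 0; ring|ring].
    + exists z. split; [apply ltS_iff; exists (u * z); ring|reflexivity].
  - delta0.
Qed.

Definition beta (i k m n : N) : Prop := i < k /\ dvd (m * (i + 1) + 1) n.

Lemma delta0_beta s t u v : term_def s -> term_def t -> term_def u -> term_def v ->
  delta0 (fun e => beta (s e) (t e) (u e) (v e)).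
Proof.
  intros Hs Ht Hu Hv. apply delta0_and; [delta0|].
  apply (delta0_dvd (fun e => u e * (s e + 1) + 1)); term_def.
Qed.

Ltac delta0_hook ::=
  lazymatch goal with
  | |- delta0 (fun e => dvd (@?s e) (@?t e)) => apply (delta0_dvd s t); term_def
  | |- delta0 (fun e => beta (@?s e) (@?t e) (@?u e) (@?v e)) =>
      apply (delta0_beta s t u v); term_def
  end.

(** Stands in for the factorial of [k]. It must not be 0, since otherwise every modulus
    [m * (i + 1) + 1] would be 1. *)
Lemma common_multiple k : exists m, m <> 0 /\ forall i, i < k -> dvd (i + 1) m.
Proof.
  revert k. apply (sigma1_induction (fun m k => m <> 0 /\ forall i, i < k -> dvd (i + 1) m)).
  - delta0.
  - exists 1. split.
    + intros E. apply (succ_neq0 0). rewrite add0n. exact E.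
    + intros i Hi. destruct (ltn0 i Hi).
  - intros k [m [Hm H]]. exists (m * (k + 1)). split.
    + destruct (zero_or_succ m) as [->|[m' ->]]; [tauto|].
      intros E. apply (succ_neq0 (m' * k + m' + k)). rewrite <- E. ring.
    + intros i Hi. apply ltnS in Hi as [Hi| ->]; [apply dvd_mulr, H, Hi|].
      apply dvd_mull.
Qed.

(* Any two moduli are coprime because their difference is [m] times a divisor of
   [m]; [m] itself is invertible modulo [m * (i + 1) + 1], the inverse being
   [- (i + 1)]. *)
Lemma beta_gauss m k i j n : (forall i, i < k -> dvd (i + 1) m) -> i < k -> j < k -> i <> j ->
  dvd (m * (i + 1) + 1) (n * (m * (j + 1) + 1)) -> dvd (m * (i + 1) + 1) n.
Proof.
  intros Hm Hi Hj Hij H. set (a := m * (i + 1) + 1) in *.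
  assert (Hinv : forall x, dvd a (x * m) -> dvd a x).
  { intros x Hx. apply dvd_add_cancel with (x * m * (i + 1)); [|apply dvd_mulr, Hx].
    exists x. unfold a. ring. }
  assert (Hd : exists z, z < k /\ dvd a (n * (m * (z + 1)))).
  { destruct (lt_total i j) as [L|[L|L]]; [|contradiction|];
      apply lt_sum in L as [z L]; exists z.
    - split; [apply (leS_lt _ j); [apply ltS_iff; exists (i + 1); rewrite L; ring|exact Hj]|].
      apply dvd_add_cancel with (n * a); [|apply dvd_mull].
      replace (n * a + n * (m * (z + 1))) with (n * (m * (j + 1) + 1)); [exact H|].
      unfold a. rewrite L. ring.
    - split; [apply (leS_lt _ i); [apply ltS_iff; exists (j + 1); rewrite L; ring|exact Hi]|].
      apply dvd_add_cancel with (n * (m * (j + 1) + 1)); [|exact H].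
      replace (n * (m * (j + 1) + 1) + n * (m * (z + 1))) with (n * a);
        [apply dvd_mull|].
      unfold a. rewrite L. ring. }
  destruct Hd as (z & Hz & Hd). destruct (Hm z Hz) as [e He].
  apply Hinv. rewrite He, mulnA. apply dvd_mulr, Hinv.
  replace (n * (z + 1) * m) with (n * (m * (z + 1))) by ring. exact Hd.
Qed.

(** Induction on [j] multiplies up the moduli of those [i < j] that satisfy [P]. *)
Lemma beta_exists (P : N -> Prop) k : delta0 (fun e => P (e O)) ->
  exists m n, forall i, beta i k m n <-> i < k /\ P i.
Proof.
  intros HP. destruct (common_multiple k) as (m & Hm0 & Hm).
  destruct (sigma1_induction (fun n j =>
    forall i, i < k -> (dvd (m * (i + 1) + 1) n <-> i < j /\ P i))) with (x := k) as [n Hn].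
  - delta0.
  (* The empty product: since [m] is not 0, every modulus is at least 2 and does not divide 1. *)
  - exists 1. intros i Hi. split; [|intros [H _]; destruct (ltn0 i H)].
    intros [z Hz]. exfalso. destruct (zero_or_succ m) as [E|[m' ->]]; [tauto|].
    destruct (zero_or_succ z) as [->|[z' ->]].
    + apply (succ_neq0 0). rewrite add0n. etransitivity; [exact Hz|]. ring.
    + apply (succ_neq0 (m' * i + m' + i + (z' * (m' * i + m' + i + 1 + 1)))).
      apply (addIn _ _ 1). rewrite add0n. etransitivity; [|symmetry; exact Hz]. ring.
  - intros j [n Hn]. destruct (classic (j < k /\ P j)) as [[Hj Pj]|Hj].
    (* By [beta_gauss] the new factor leaves divisibility by the modulus of any other [i]
       unchanged. *)
    + exists (n * (m * (j + 1) + 1)). intros i Hi. rewrite ltnS.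
      destruct (classic (i = j)) as [->|Hij].
      * split; [auto|]. intros _. apply dvd_mull.
      * split.
        -- intros H. apply (beta_gauss m k i j n Hm Hi Hj Hij), (Hn i Hi) in H. tauto.
        -- intros H. apply dvd_mulr, (Hn i Hi). tauto.
    + exists n. intros i Hi. rewrite (Hn i Hi), ltnS. split; [tauto|].
      intros [[H| ->] Pi]; tauto.
  - exists m, n. intros i. unfold beta. split.
    + intros [Hi H]. apply (Hn i Hi) in H. exact H.
    + intros [Hi H]. split; [exact Hi|]. apply (Hn i Hi); auto.
Qed.

Definition pair (i j : N) : N := (i + j) * (i + j) + i.
Definition triple (k m n : N) : N := pair k (pair m n).

(** [pair i j] is at least the square of [i + j] and less than the next square, so the pair
    determines the sum. *)
Lemma pair_sum_le i j i' j' : pair i j = pair i' j' -> ~ i + j < i' + j'.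
Proof.
  unfold pair. intros E H. apply lt_sum in H as [z H]. rewrite H in E.
  (* This is the excess of the second pair over the first, minus one. *)
  apply (succ_neq0 ((i + j) * (1 + 1) * z + z * z + z * (1 + 1) + i + j + j + i')).
  apply (addIn _ _ ((i + j) * (i + j) + i)). rewrite add0n.
  etransitivity; [|symmetry; exact E]. ring.
Qed.

Lemma pair_inj i j i' j' : pair i j = pair i' j' -> i = i' /\ j = j'.
Proof.
  intros E. assert (Es : i + j = i' + j').
  { destruct (lt_total (i + j) (i' + j')) as [H|[H|H]]; [|exact H|];
      apply pair_sum_le in H; [contradiction|exact E|contradiction|auto]. }
  unfold pair in E. rewrite Es, addnC, (addnC _ i') in E. apply addIn in E as ->.
  split; [reflexivity|]. rewrite !(addnC i') in Es. exact (addIn _ _ _ Es).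
Qed.

Lemma triple_inj k m n k' m' n' :
  triple k m n = triple k' m' n' -> k = k' /\ m = m' /\ n = n'.
Proof. intros E. apply pair_inj in E as [-> E]. apply pair_inj in E as [-> ->]. auto. Qed.

Lemma pair_le_l i j : i < pair i j + 1.
Proof. apply ltS_iff. exists ((i + j) * (i + j)). unfold pair. ring. Qed.

Lemma pair_le_r i j : j < pair i j + 1.
Proof.
  apply ltS_iff. unfold pair. destruct (zero_or_succ j) as [->|[u ->]].
  - exists (i * i + i). ring.
  - exists (i * i + i * (u + 1) * (1 + 1) + u * (u + 1) + i). ring.
Qed.

Lemma leS_trans x y z : x < y + 1 -> y < z + 1 -> x < z + 1.
Proof. exact (leS_lt x y (z + 1)). Qed.

Lemma triple_bound k m n :
  k < triple k m n + 1 /\ m < triple k m n + 1 /\ n < triple k m n + 1.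
Proof.
  unfold triple. split; [apply pair_le_l|].
  split; apply (leS_trans _ (pair m n)); auto using pair_le_l, pair_le_r.
Qed.

Definition same_set (k m n k' m' n' : N) : Prop :=
  forall i, beta i k m n <-> beta i k' m' n'.

Definition elem (i c : N) : Prop :=
  exists k m n, c = triple k m n /\ beta i k m n.

Definition code (c : N) : Prop :=
  exists k m n, c = triple k m n /\
    forall k' m' n', same_set k m n k' m' n' -> c < triple k' m' n' \/ c = triple k' m' n'.

Lemma elem_triple i k m n : elem i (triple k m n) <-> beta i k m n.
Proof.
  split; [|intros H; exists k, m, n; auto].
  intros (k' & m' & n' & E & H). apply triple_inj in E as (-> & -> & ->). exact H.
Qed.

(** [i < k], and [k] is at most the triple. This bounds every quantifier over the elements of a
    coded set. *)
Lemma elem_lt i c : elem i c -> i < c.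
Proof.
  intros (k & m & n & -> & Hi & _). apply (lt_leS _ _ _ Hi), triple_bound.
Qed.

Lemma delta0_elem s t : term_def s -> term_def t -> delta0 (fun e => elem (s e) (t e)).
Proof.
  intros Hs Ht. apply delta0_ext with (fun e =>
    exists k, k < t e + 1 /\ exists m, m < t e + 1 /\ exists n, n < t e + 1 /\
      (t e = triple k m n /\ beta (s e) k m n)).
  - intros e. split.
    + intros (k & _ & m & _ & n & _ & H). exists k, m, n. exact H.
    + intros (k & m & n & E & H). destruct (triple_bound k m n) as (Hk & Hm & Hn).
      rewrite <- E in Hk, Hm, Hn.
      exists k. split; [exact Hk|]. exists m. split; [exact Hm|]. exists n. auto.
  - unfold triple, pair. delta0.
Qed.

Lemma delta0_same_set (k m n k' m' n' : env -> N) :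
  term_def k -> term_def m -> term_def n -> term_def k' -> term_def m' -> term_def n' ->
  delta0 (fun e => same_set (k e) (m e) (n e) (k' e) (m' e) (n' e)).
Proof.
  intros Hk Hm Hn Hk' Hm' Hn'. apply delta0_ext with (fun e =>
    forall i, i < k e + k' e -> (beta i (k e) (m e) (n e) <-> beta i (k' e) (m' e) (n' e))).
  - intros e. split; [|intros H i _; apply H].
    intros H i. split; intros Hi; apply H; try exact Hi; destruct Hi as [Hi _];
      [apply lt_addr, Hi|apply lt_addl, Hi].
  - delta0.
Qed.

Ltac delta0_hook ::=
  lazymatch goal with
  | |- delta0 (fun e => dvd (@?s e) (@?t e)) => apply (delta0_dvd s t); term_def
  | |- delta0 (fun e => beta (@?s e) (@?t e) (@?u e) (@?v e)) =>
      apply (delta0_beta s t u v); term_def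
  | |- delta0 (fun e => elem (@?s e) (@?t e)) => apply (delta0_elem s t); term_def
  | |- delta0 (fun e => same_set (@?k e) (@?m e) (@?n e) (@?k' e) (@?m' e) (@?n' e)) =>
      apply (delta0_same_set k m n k' m' n'); term_def
  end.

Lemma leS_iff x y : x < y \/ x = y <-> ~ y < x.
Proof.
  rewrite <- ltnS. split.
  - intros H1 H2. exact (lt_ge_false _ _ H2 H1).
  - intros H. apply ltnS. destruct (lt_total x y) as [L|[L|L]]; auto. contradiction.
Qed.

(** Minimality concerns only the triples below the code, and their components lie below the code
    too, so all quantifiers can be bounded. *)
Lemma delta0_code t : term_def t -> delta0 (fun e => code (t e)).
Proof.
  intros Ht. apply delta0_ext with (fun e =>
    exists k, k < t e + 1 /\ exists m, m < t e + 1 /\ exists n, n < t e + 1 /\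
      (t e = triple k m n /\
       forall k', k' < t e -> forall m', m' < t e -> forall n', n' < t e ->
         same_set k m n k' m' n' -> ~ triple k' m' n' < t e)).
  - intros e. split.
    + intros (k & _ & m & _ & n & _ & E & H). exists k, m, n. split; [exact E|].
      intros k' m' n' Hs. apply leS_iff. intros L. revert L Hs.
      destruct (triple_bound k' m' n') as (Hk & Hm & Hn).
      intros L Hs. exact (H k' (leS_lt _ _ _ Hk L) m' (leS_lt _ _ _ Hm L)
        n' (leS_lt _ _ _ Hn L) Hs L).
    + intros (k & m & n & E & H). destruct (triple_bound k m n) as (Hk & Hm & Hn).
      rewrite <- E in Hk, Hm, Hn.
      exists k. split; [exact Hk|]. exists m. split; [exact Hm|]. exists n. split; [exact Hn|].
      split; [exact E|]. intros k' _ m' _ n' _ Hs. apply leS_iff, H, Hs.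
  - unfold triple, pair. delta0.
Qed.

(** Each code is minimal among the triples for the common set. Hence membership in D depends only on
    the set coded. *)
Lemma code_ext c d : code c -> code d -> (forall i, elem i c <-> elem i d) -> c = d.
Proof.
  intros (k & m & n & -> & H) (k' & m' & n' & -> & H') E.
  assert (Hs : same_set k m n k' m' n').
  { intros i. rewrite <- !elem_triple. apply E. }
  assert (Hs' : same_set k' m' n' k m n) by (intros i; symmetry; apply Hs).
  apply H in Hs as [L|L]; [|exact L]. apply H' in Hs' as [L'|L']; [|auto].
  destruct (ltnn _ (lt_trans _ _ _ L L')).
Qed.

(** [beta_exists] supplies one triple, and the least number principle the least. Being a triple for
    [P] is bounded because both sets can be compared below [k + b]. *)
Lemma code_exists (P : N -> Prop) b : delta0 (fun e => P (e O)) ->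
  (forall i, P i -> i < b) -> exists c, code c /\ forall i, elem i c <-> P i.
Proof.
  intros HP Hb. destruct (beta_exists P b HP) as (m & n & Hmn).
  set (Q := fun c => exists k m n, c = triple k m n /\ forall i, beta i k m n <-> P i).
  destruct (delta0_least Q (triple b m n)) as (c & (k & m' & n' & -> & H) & Hleast).
  - apply delta0_ext with (fun e =>
      exists k, k < e O + 1 /\ exists m, m < e O + 1 /\ exists n, n < e O + 1 /\
        (e O = triple k m n /\ forall i, i < k + b -> (beta i k m n <-> P i))).
    + clear m n Hmn. intros e. split.
      * intros (k & _ & m & _ & n & _ & E & H). exists k, m, n. split; [exact E|].
        intros i. split; intros Hi; apply H; try exact Hi;
          [apply lt_addr, Hi|apply lt_addl, Hb, Hi].
      * intros (k & m & n & E & H). destruct (triple_bound k m n) as (Hk & Hm & Hn).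
        rewrite <- E in Hk, Hm, Hn.
        exists k. split; [exact Hk|]. exists m. split; [exact Hm|]. exists n. auto.
    + unfold triple, pair. delta0.
  - exists b, m, n. split; [reflexivity|]. intros i. rewrite Hmn. split; [tauto|]. auto.
  - exists (triple k m' n'). split.
    + exists k, m', n'. split; [reflexivity|]. intros k2 m2 n2 Hs.
      apply leS_iff, Hleast. exists k2, m2, n2. split; [reflexivity|].
      intros i. rewrite <- H. symmetry. apply Hs.
    + intros i. rewrite elem_triple. apply H.
Qed.

(** * The greedy basis *)

Section Greedy.

Context (E D : sets M).

(** Cutting [s] off at [i] recovers the set that was kept when [i] was examined, so a single [s]
    certifies all the decisions. *)
Definition extension (c s i : N) : Prop :=
  code c /\ forall j, elem j c <-> elem j s /\ j < i \/ j = i.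

(* [s] represents the greedy basis below [x]; the bound [w] on the codes of the
   sets tested for membership in [D] makes the formula bounded. *)
Definition greedy (x s w : N) : Prop :=
  (forall j, elem j s -> j < x) /\
  forall i, i < x -> exists c, c < w /\
    (extension c s i /\ (elem i s <-> mem M i E /\ ~ mem M c D)).

Lemma delta0_extension t u v : term_def t -> term_def u -> term_def v ->
  delta0 (fun e => extension (t e) (u e) (v e)).
Proof.
  intros Ht Hu Hv. apply delta0_and; [apply delta0_code, Ht|].
  apply delta0_ext with (fun e => forall j, j < t e + (v e + 1) ->
    (elem j (t e) <-> elem j (u e) /\ j < v e \/ j = v e)).
  - intros e. split; [|auto]. intros H j. split; intros Hj; apply H; try exact Hj.
    + apply lt_addr, elem_lt, Hj.
    + apply lt_addl, ltnS. destruct Hj as [[_ Hj]| ->]; auto.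
  - delta0.
Qed.

Ltac delta0_hook ::=
  lazymatch goal with
  | |- delta0 (fun e => elem (@?s e) (@?t e)) => apply (delta0_elem s t); term_def
  | |- delta0 (fun e => extension (@?s e) (@?t e) (@?u e)) =>
      apply (delta0_extension s t u); term_def
  end.

Lemma delta0_greedy t u v : term_def t -> term_def u -> term_def v ->
  delta0 (fun e => greedy (t e) (u e) (v e)).
Proof.
  intros Ht Hu Hv. apply delta0_and; [|delta0].
  apply delta0_ext with (fun e => forall j, j < u e -> elem j (u e) -> j < t e).
  - intros e. split; [|auto]. intros H j Hj. apply (H j (elem_lt _ _ Hj) Hj).
  - delta0.
Qed.

Ltac delta0_hook ::=
  lazymatch goal with
  | |- delta0 (fun e => elem (@?s e) (@?t e)) => apply (delta0_elem s t); term_def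
  | |- delta0 (fun e => code (@?t e)) => apply (delta0_code t); term_def
  | |- delta0 (fun e => greedy (@?s e) (@?t e) (@?u e)) =>
      apply (delta0_greedy s t u); term_def
  end.

(** Agreement below [k] gives the two tests at [k] the same set, hence by [code_ext] the same code,
    and so the same outcome. *)
Lemma greedy_unique x s w x' s' w' : greedy x s w -> greedy x' s' w' ->
  forall i, i < x -> i < x' -> (elem i s <-> elem i s').
Proof.
  intros [_ H] [_ H'].
  assert (Hind : forall k i, i < k -> i < x -> i < x' -> (elem i s <-> elem i s')).
  { intros k. ind k; [intros i Hi; destruct (ltn0 i Hi)|].
    intros i Hi. apply ltnS in Hi as [Hi| ->]; [exact (IH i Hi)|]. intros Hx Hx'.
    destruct (H k Hx) as (c & _ & [Hc Hcs] & ->).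
    destruct (H' k Hx') as (c' & _ & [Hc' Hcs'] & ->).
    replace c' with c; [reflexivity|]. apply code_ext; [assumption..|].
    intros j. rewrite Hcs, Hcs'.
    assert (Hj : j < k -> (elem j s <-> elem j s')).
    { intros Hj. apply IH; [exact Hj|..]; eapply lt_trans; eassumption. }
    tauto. }
  intros i. apply (Hind (i + 1)), ltnS. auto.
Qed.

Lemma greedy_sub x s w : greedy x s w -> forall i, elem i s -> mem M i E.
Proof.
  intros [Hs H] i Hi. destruct (H i (Hs i Hi)) as (c & _ & _ & Hc). tauto.
Qed.

Context (Hempty : forall c, code c -> (forall i, ~ elem i c) -> ~ mem M c D).

(** Since [w] also bounds [s], one unbounded quantifier remains and Sigma^0_1 induction applies.
    Independence of [s] is carried through the induction. *)
Lemma greedy_exists x : exists w s, s < w /\ (code s /\ ~ mem M s D /\ greedy x s w).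
Proof.
  revert x. apply (sigma1_induction (fun w x =>
    exists s, s < w /\ (code s /\ ~ mem M s D /\ greedy x s w))).
  - delta0.
  - destruct (code_exists (fun _ => False) 0) as (s & Hs & He); [delta0|tauto|].
    exists (s + 1), s. split; [apply ltnS; auto|]. split; [exact Hs|]. split.
    + apply Hempty; [exact Hs|]. intros i Hi. exact (proj1 (He i) Hi).
    + split; [intros j Hj; destruct (proj1 (He j) Hj)|].
      intros i Hi. destruct (ltn0 i Hi).
  - intros x (w & s & Hsw & Hs & HsD & Hlt & Hg).
    (* [c] is the set tested at [x]; the new bound [w + (c + 1)] exceeds both the old codes and
       [c]. *)
    destruct (code_exists (fun j => elem j s \/ j = x) (x + 1)) as (c & Hc & Hcs);
      [delta0|intros i Hi; apply ltnS; destruct Hi; auto|].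
    assert (Hw : forall i, i < w -> i < w + (c + 1)) by (intros i; apply lt_addr).
    assert (Hcw : c < w + (c + 1)) by (apply lt_addl, ltnS; auto).
    assert (Hx : ~ elem x s) by (intros Hx; exact (ltnn x (Hlt x Hx))).
    exists (w + (c + 1)). destruct (classic (mem M x E /\ ~ mem M c D)) as [Hin|Hout].
    + exists c. split; [exact Hcw|]. split; [exact Hc|]. split; [apply Hin|]. split.
      * intros j Hj. apply ltnS. apply Hcs in Hj as [Hj| ->]; auto.
      (* Adding [x] changes nothing below [x], so the codes of the earlier tests stay valid. *)
      * assert (Hlow : forall i, i < x -> (elem i c <-> elem i s)).
        { intros i Hi. rewrite Hcs. split; [|auto]. intros [H| ->]; [exact H|].
          destruct (ltnn x Hi). }
        intros i Hi. apply ltnS in Hi as [Hi| ->].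
        -- destruct (Hg i Hi) as (d & Hd & [Hdc Hds] & Hiff).
           exists d. split; [auto|]. rewrite (Hlow i Hi). split; [|exact Hiff].
           split; [exact Hdc|]. intros j. rewrite Hds.
           assert (Hj : j < i -> (elem j c <-> elem j s)).
           { intros Hj. apply Hlow, (lt_trans _ i); assumption. }
           tauto.
        -- exists c. split; [exact Hcw|]. split; [|rewrite Hcs; tauto].
           split; [exact Hc|]. intros j. rewrite Hcs. split; [|tauto].
           intros [Hj| ->]; auto.
    + exists s. split; [auto|]. split; [exact Hs|]. split; [exact HsD|]. split.
      * intros j Hj. apply ltnS. auto.
      * intros i Hi. apply ltnS in Hi as [Hi| ->].
        -- destruct (Hg i Hi) as (d & Hd & H). exists d. auto.
        -- exists c. split; [exact Hcw|]. split; [|tauto].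
           split; [exact Hc|]. intros j. rewrite Hcs. split; [|tauto].
           intros [Hj| ->]; auto.
Qed.

(** Records for [x + 1] are consulted because they are the first to decide [x]. Existence turns the
    universal definition into the existential one, and uniqueness gives the converse. *)
Lemma greedy_set : exists B, forall x s w, greedy x s w ->
  forall i, elem i s <-> i < x /\ mem M i B.
Proof.
  destruct (delta1_comprehension
    (fun w x => exists s, s < w /\ (greedy (x + 1) s w /\ elem x s))
    (fun w x => forall s, s < w -> greedy (x + 1) s w -> elem x s)) as [B HB].
  - delta0.
  - delta0.
  - intros x. assert (Hx : x < x + 1) by (apply ltnS; auto). split.
    + intros (w & s & _ & Hg & He) w' s' _ Hg'.
      apply (greedy_unique _ _ _ _ _ _ Hg Hg' x Hx Hx), He.
    + intros H. destruct (greedy_exists (x + 1)) as (w & s & Hsw & _ & _ & Hg).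
      exists w, s. eauto.
  - exists B. intros x s w Hg i. assert (Hi : i < i + 1) by (apply ltnS; auto).
    rewrite HB. split.
    + intros He. pose proof (proj1 Hg i He) as Hix. split; [exact Hix|].
      destruct (greedy_exists (i + 1)) as (w' & s' & Hsw' & _ & _ & Hg').
      exists w', s'. split; [exact Hsw'|]. split; [exact Hg'|].
      apply (greedy_unique _ _ _ _ _ _ Hg Hg' i Hix Hi), He.
    + intros (Hix & w' & s' & _ & Hg' & He).
      apply (greedy_unique _ _ _ _ _ _ Hg Hg' i Hix Hi), He.
Qed.

Context (Hup : forall c d, mem M c D -> code d -> (forall i, elem i d -> mem M i E) ->
  (forall i, elem i c -> elem i d) -> mem M d D).

Lemma greedy_basis : exists B,
  (forall x, mem M x B -> mem M x E) /\
  (forall c, code c -> (forall i, elem i c -> mem M i B) -> ~ mem M c D) /\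
  (forall x, mem M x E -> ~ mem M x B ->
     exists c, code c /\ (forall i, elem i c -> mem M i B \/ i = x) /\ mem M c D).
Proof.
  destruct greedy_set as [B HB]. exists B. split; [|split].
  - intros x Hx. destruct (greedy_exists (x + 1)) as (w & s & _ & _ & _ & Hg).
    apply (greedy_sub _ _ _ Hg), (HB _ _ _ Hg). split; [apply ltnS; auto|exact Hx].
  (* The elements of [c] lie below the number [c], so the stage at [c] already contains them all; a
     dependent [c] would make that stage dependent. *)
  - intros c Hc Hsub Hdep. destruct (greedy_exists c) as (w & s & _ & Hs & HsD & Hg).
    apply HsD. apply (Hup c); [assumption..|exact (greedy_sub _ _ _ Hg)|].
    intros i Hi. apply (HB _ _ _ Hg). auto using elem_lt.
  - intros x HxE HxB. destruct (greedy_exists (x + 1)) as (w & s & _ & _ & _ & Hg).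
    destruct (proj2 Hg x) as (c & _ & [Hc Hcs] & Hx); [apply ltnS; auto|].
    exists c. split; [exact Hc|]. split.
    + intros i Hi. apply Hcs in Hi as [[Hi _]|Hi]; [left; apply (HB _ _ _ Hg i), Hi|auto].
    (* Had the tested set been outside [D], the greedy rule would have kept [x]. *)
    + apply NNPP. intros HcD. apply HxB, (HB _ _ _ Hg x), Hx. auto.
Qed.

End Greedy.

(** * From the formulas for codes, matroids and bases to their meaning in a model *)

Lemma sat_beta e q i k m n : sat M e q (beta_mem i k m n) <->
  beta (eval M e i) (eval M e k) (eval M e m) (eval M e n).
Proof.
  unfold beta_mem, divides. rewrite sat_and, sat_exN. apply and_iff_compat_l.
  split; intros [z Hz]; exists z; cbn [sat eval] in *; rewrite !eval_lift1 in *; exact Hz.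
Qed.

Lemma sat_is_code e q t : sat M e q (is_code t) <-> code (eval M e t).
Proof.
  unfold is_code, code. rewrite sat_exN. apply exists_iff. intros k.
  rewrite sat_exN. apply exists_iff. intros m. rewrite sat_exN. apply exists_iff. intros n.
  rewrite sat_and. cbn [sat]. rewrite eval_lift. apply and_iff_compat_l.
  do 3 (apply forall_iff; intros ?). unfold fle. rewrite sat_or. cbn [sat].
  rewrite eval_lift.
  assert (Hiff : forall A B C : Prop, (A <-> B) -> ((A -> C) <-> (B -> C))) by tauto.
  apply Hiff. apply forall_iff. intros i. rewrite sat_iff, !sat_beta. reflexivity.
Qed.

Lemma sat_fmem e q i c : sat M e q (fmem i c) <-> elem (eval M e i) (eval M e c).
Proof.
  unfold fmem, elem. rewrite sat_exN. apply exists_iff. intros k.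
  rewrite sat_exN. apply exists_iff. intros m. rewrite sat_exN. apply exists_iff. intros n.
  rewrite sat_and, sat_beta. cbn [sat]. rewrite !eval_lift. reflexivity.
Qed.

Lemma sat_fin_subset e q c X : sat M e q (fin_subset c X) <->
  code (eval M e c) /\ forall i, elem i (eval M e c) -> mem M i (q X).
Proof.
  unfold fin_subset. rewrite sat_and, sat_is_code. apply and_iff_compat_l.
  cbn [sat]. apply forall_iff. intros i. rewrite sat_fmem, eval_lift1. reflexivity.
Qed.

Lemma matroid_basis e q :
  sat M e q (matroid 1 0) -> exists B, sat M e (scons B q) (basis 0 2 1).
Proof.
  unfold matroid. rewrite !sat_and. cbn [sat]. intros (_ & Hempty & Hup & _).
  destruct (greedy_basis (q (S O)) (q O)) as (B & HBE & Hind & Hspan).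
  - intros c Hc He. specialize (Hempty c). revert Hempty.
    rewrite sat_and, sat_is_code. unfold fempty. intros H. apply H. split; [exact Hc|].
    intros i Hi. apply (He i). apply sat_fmem in Hi. exact Hi.
  - intros c d Hc Hd Hsub Hcd. specialize (Hup c d). revert Hup.
    rewrite !sat_and, sat_fin_subset. unfold fsubset. intros H. apply H.
    split; [exact Hc|]. split; [split; assumption|].
    intros i. cbn [sat]. rewrite !sat_fmem. apply Hcd.
  - exists B. unfold basis, independent, spans. rewrite !sat_and. cbn [sat]. split; [exact HBE|].
    split.
    + intros c Hc. apply sat_fin_subset in Hc as [Hc Hsub]. exact (Hind c Hc Hsub).
    + intros x Hx. apply sat_and in Hx as [HxE HxB].
      destruct (Hspan x HxE HxB) as (c & Hc & Hsub & HcD).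
      apply sat_exN. exists c. rewrite !sat_and, sat_is_code.
      split; [exact Hc|]. split; [|exact HcD].
      intros i Hi. apply sat_or, Hsub. apply sat_fmem in Hi. exact Hi.
Qed.

End Model.

Theorem theorem2p1 : proves RCA0 every_matroid_has_a_basis.
Proof.
  apply completeness; [exact RCA0_subst|]. intros M HM e q E D Hmat.
  (* The ground set [E] also serves as the default set [X0]. *)
  apply sat_exS. exact (matroid_basis M E HM e (scons D (scons E q)) Hmat).
Qed.
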